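(* Let $B$ be a B-ESG grammar, let $SR=L\leftarrow I\rightarrow R$ be a string graph rewrite rule, and let $B'$ be obtained from $B$ by a B-ESG transformation step using $SR$, so that $(B,B')$ is a B-ESG rewrite pattern. Then $(B,B')$ is admissible: for any pattern instantiation consisting of concrete derivations $S\Rightarrow^B_*F$ and $S\Rightarrow^{B'}_*F'$ (using the same sequence of productions and vertices), the string graph $F'$ can be obtained from $F$ by repeated applications of $SR$.
   Context: Graphs: a graph over $\Sigma,\Gamma$ is $H=(V,E,\lambda)$ with $V$ finite, $E\subseteq\{(v,\gamma,w): v\neq w,\gamma\in\Gamma\}$, $\lambda:V\to\Sigma$. A graph with embedding is $(D,C)$ with $C\subseteq\Sigma\times\Gamma\times\Gamma\times V_D\times\{in,out\}$, elements written $(\sigma,\beta/\gamma,x,d)$; a vertex $x$ has connection instructions if some element of $C$ has fourth component $x$. An edNCE grammar $G=(\Sigma,\Delta,\Gamma,\Omega,P,S)$ has terminal labels $\Delta$, final edge labels $\Omega$, finitely many productions $X\to(D,C)$ ($X$ non-terminal), initial non-terminal $S$. Applying $X\to(D,C)$ to an $X$-labelled vertex $v$: delete $v$, add a copy of $D$, and for every $\beta$-edge between $v$ and a $\sigma$-labelled vertex $w$ directed into $v$ ($d=in$) or out of $v$ ($d=out$) and each $(\sigma,\beta/\gamma,x,d)\in C$, add a $\gamma$-edge between $w$ and $x$ ($w\to x$ if $d=in$, $x\to w$ if $d=out$). B-edNCE: production bodies have no adjacent non-terminals and no instruction has non-terminal $\sigma$. String graphs: for disjoint label sets $\mathcal N$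 (node-vertices), $\mathcal W$ (wire-vertices), a string graph is a directed graph labelled in $\mathcal N\cup\mathcal W$ with no edge between node-vertices and all wire-vertices of in- and out-degree at most one. Inputs/outputs: wire-vertices with no incoming/outgoing edges; boundary = inputs and outputs. Wire-homeomorphism $G\sim G'$: obtained by finitely many mergings of two adjacent wire-vertices or splittings of a wire-vertex into two adjacent ones. A matching of a string graph $L$ with boundary $B_L$ onto a string graph $H$ is an injective label-preserving homomorphism $m:L\to\widetilde H$, $\widetilde H\sim H$, such that every edge joining a vertex of $m(L)$ to a vertex outside it is incident to $m(B_L)$. A string graph rewrite rule is a span $L\leftarrow I\rightarrow R$ with $I$ the common boundary of $L$ and $R$; applying it along a matching is a double pushout (pushout complement then pushout) in the category of string graphs. Encoded string graph: string graph where edges labelled by encoding symbols $\alpha\in\mathcal E$ may also join node-vertices. Decoding system $T$: for each $(\alpha,N_1,N_2)\in\mathcal E\times\mathcal N\times\mathcal N$ one DPO rule replacing a single $\alpha$-edge from an $N_1$ node-vertex to an $N_2$ node-vertex (interface: the two node-vertices) by a connected string graph with no inputs, outputs or encoding labels. B-ESG grammar $B=(G,T)$: $T$ a decoding system, $G=(\Sigma,\Delta,\Gamma,\Gamma,P,S)$ B-edNCE with $\Delta=\mathcal N\cup\mathcal W$, $\mathcal E\subseteq\Gamma$, and for each production $X\to(D,C)$: (N1) an edge of $D$ has encoding label iff it joins two node-vertices; (N2) instructions $(N,\alpha/\beta,x,d)$ with $N\in\mathcal N$, $x$ a node-vertex have $\beta\in\mathcal E$; (W1) wire-vertices of $D$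 have in- and out-degree at most one; (W2) no instruction $(\sigma,\alpha/\beta,x,d)$ has $x$ a wire-vertex; (W3) for each $W\in\mathcal W,\gamma,d$ at most one instruction $(W,\gamma/\delta,x,d)$, and $\delta\notin\mathcal E$; (W4) if a non-terminal $y$ with label $Y$ in $D$ is adjacent to a $W$-labelled wire-vertex via an edge of direction $d$ and label $\beta$, or there is an instruction $(W,\alpha/\beta,y,d)$, then all productions for $Y$ contain an instruction $(W,\beta/\gamma,z,d)$. A concrete derivation is a derivation in $G$ from a single $S$-vertex to a graph without non-terminals, followed by decoding with $T$. B-ESG rewrite pattern: a pair of B-ESG grammars $B_1=(G_1,T)$, $B_2=(G_2,T)$ over the same alphabets and initial non-terminal, with a bijective correspondence between their productions pairing productions with the same left-hand side, such that corresponding bodies have a label-preserving bijection between their non-terminal vertices (NT) and bijections between their inputs and between their outputs (IO). A pattern instantiation is a pair of concrete derivations, one in each grammar, applying the identical sequence of (vertex, corresponding production) steps, followed by decoding with $T$. Final subgraph: for a production $X\to(D,C)$, a subgraph $S'$ of $D$ is final if $S'$ is a string graph, not adjacent to any non-terminal vertex of $D$, and no vertex of $S'$ has connection instructions in $C$. B-ESG transformation step using $SR$: some production $p=X\to(D,C)$ of $G$ admits a matching of $L$ into a final subgraph of $D$, and $G'$ equals $G$ except that $p$ is replaced by $p'=X\to(D',C)$, $D'$ being the result of rewriting $D$ with $SR$ at that matching; $B'=(G',T)$, with productions of $B$ and $B'$ corresponding via $p\leftrightarrow p'$ and identity otherwise. *)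

(* Defs.v *)
From Stdlib Require Import Relation_Operators.
From mathcomp Require Import all_boot.

Set Implicit Arguments.
Unset Strict Implicit.
Unset Printing Implicit Defensive.

Record alphabets := Alphabets {
  Sigma : finType;
  Gamma : finType;
  NodeL : {set Sigma};
  WireL : {set Sigma};
  Enc : {set Gamma};
  node_wire_disjoint : [disjoint NodeL & WireL] }.

Section Graphs.

Variable A : alphabets.

Record graph := Graph {
  vert :> finType;
  edges : {set vert * Gamma A * vert};
  lab : vert -> Sigma A;
  edges_irrefl : forall v c w, (v, c, w) \in edges -> v != w }.

Definition emap (V W : Type) (f : V -> W) (e : V * Gamma A * V) :
  W * Gamma A * W := (f e.1.1, e.1.2, f e.2).

Definition is_hom (G H : graph) (f : G -> H) : Prop :=
  (forall v, lab (f v) = lab v) /\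
  (forall e, e \in edges G -> emap f e \in edges H).

Definition is_mono (G H : graph) (f : G -> H) : Prop :=
  is_hom f /\ injective f.

Definition is_iso (G H : graph) (f : G -> H) : Prop :=
  [/\ bijective f, forall v, lab (f v) = lab v &
      forall e, (emap f e \in edges H) = (e \in edges G)].

Definition iso (G H : graph) : Prop := exists f : G -> H, is_iso f.

Definition all_graphs (G : graph) : Prop := True.

(* The pushout of k and i in the full subcategory on the class C. *)
Definition is_pushout (C : graph -> Prop) (I L K G : graph)
    (i : I -> L) (k : I -> K) (m : L -> G) (g : K -> G) : Prop :=
  [/\ [/\ C I, C L, C K & C G],
      [/\ is_hom i, is_hom k, is_hom m & is_hom g],
      (forall x, m (i x) = g (k x)) &
      forall (X : graph) (a : L -> X) (b : K -> X),
        C X -> is_hom a -> is_hom b -> (forall x, a (i x) = b (k x)) ->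
        exists u : G -> X,
          [/\ is_hom u, u \o m =1 a, u \o g =1 b &
              forall u' : G -> X,
                is_hom u' -> u' \o m =1 a -> u' \o g =1 b -> u' =1 u]].

(* Edges form a plain set, so a pushout square alone does not force the edges
   of L that are not in I to be absent from K; the second clause selects the
   usual pushout complement, in which they are deleted. *)
Definition is_pushout_complement (C : graph -> Prop) (I L K G : graph)
    (i : I -> L) (k : I -> K) (m : L -> G) (g : K -> G) : Prop :=
  is_pushout C i k m g /\
  (forall e e', e \in edges L -> e' \in edges K -> emap m e = emap g e' ->
     exists2 e0, e0 \in edges I & e = emap i e0).

(* G <-g- K -h-> H is the lower row of a double pushout along m. *)
Definition double_pushout (C : graph -> Prop) (I L R K G H : graph)
    (i : I -> L) (j : I -> R) (m : L -> G) (g : K -> G) (h : K -> H) : Prop :=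
  exists (k : I -> K) (n : R -> H),
    is_pushout_complement C i k m g /\ is_pushout C j k n h.

Definition terminals : {set Sigma A} := NodeL A :|: WireL A.

Section Vertices.
Variable G : graph.

Definition is_node (v : G) : bool := lab v \in NodeL A.
Definition is_wire (v : G) : bool := lab v \in WireL A.
Definition is_nonterminal (v : G) : bool := lab v \notin terminals.

Definition indeg (v : G) : nat := #|[set e in edges G | e.2 == v]|.
Definition outdeg (v : G) : nat := #|[set e in edges G | e.1.1 == v]|.

Definition is_input (v : G) : bool := is_wire v && (indeg v == 0).
Definition is_output (v : G) : bool := is_wire v && (outdeg v == 0).
Definition is_boundary (v : G) : bool := is_input v || is_output v.

Definition adjacent : rel G :=
  fun v w => [exists c, ((v, c, w) \in edges G) || ((w, c, v) \in edges G)].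

Definition connected : Prop := forall v w : G, connect adjacent v w.

Definition no_encoding : Prop := forall e, e \in edges G -> e.1.2 \notin Enc A.

Definition wire_degrees : Prop :=
  forall v : G, is_wire v -> indeg v <= 1 /\ outdeg v <= 1.

Definition string_graph : Prop :=
  [/\ forall v : G, lab v \in terminals,
      forall e, e \in edges G -> ~~ (is_node e.1.1 && is_node e.2),
      wire_degrees &
      no_encoding].

(* Splitting w: Some w keeps the incoming edges, None takes over the outgoing
   ones, and a new c-labelled edge joins Some w to None. *)
Definition split_src (w v : G) : option G := if v == w then None else Some v.

Definition split_edge (w : G) (e : G * Gamma A * G) :
  option G * Gamma A * option G := (split_src w e.1.1, e.1.2, Some e.2).

Definition split_edges (w : G) (c : Gamma A) (s : {set G * Gamma A * G}) :
  {set option G * Gamma A * option G} :=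
  (Some w, c, None) |: [set split_edge w e | e in s].

Definition split_lab (w : G) (x : option G) : Sigma A :=
  if x is Some v then lab v else lab w.

Lemma split_irrefl (w : G) (c : Gamma A) v d u :
  (v, d, u) \in split_edges w c (edges G) -> v != u.
Proof.
rewrite !inE => /orP [/eqP [-> _ ->] //|/imsetP [[[a b] x] /= he [-> _ ->]]].
rewrite /split_src; case: (a =P w) => // _.
exact: edges_irrefl he.
Qed.

Definition split_graph (w : G) (c : Gamma A) : graph :=
  @Graph (option G) (split_edges w c (edges G)) (split_lab w)
    (@split_irrefl w c).

End Vertices.

Definition wire_split (G H : graph) : Prop :=
  exists (w : G) (c : Gamma A),
    [/\ is_wire w, c \notin Enc A & iso (split_graph w c) H].

(* Merging two adjacent wire-vertices is the converse of splitting one. *)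
Definition wire_homeo : graph -> graph -> Prop :=
  clos_refl_sym_trans graph (fun G H => iso G H \/ wire_split G H).

Definition matching (L H Ht : graph) (m : L -> Ht) : Prop :=
  [/\ string_graph H, wire_homeo H Ht, is_mono m &
      forall e, e \in edges Ht ->
        (e.1.1 \in codom m) != (e.2 \in codom m) ->
        exists2 b : L, is_boundary b & (m b = e.1.1) \/ (m b = e.2)].

Record sg_rule := SGRule {
  rL : graph;
  rI : graph;
  rR : graph;
  ri : rI -> rL;
  rj : rI -> rR;
  rL_string : string_graph rL;
  rR_string : string_graph rR;
  rI_discrete : edges rI = set0;
  ri_mono : is_mono ri;
  rj_mono : is_mono rj;
  ri_boundary : forall x : rL, is_boundary x <-> exists b, ri b = x;
  rj_boundary : forall x : rR, is_boundary x <-> exists b, rj b = x;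
  r_inputs : forall b, is_input (ri b) = is_input (rj b);
  r_outputs : forall b, is_output (ri b) = is_output (rj b) }.

Definition sg_apply (SR : sg_rule) (H H' : graph) : Prop :=
  exists (Ht K : graph) (m : rL SR -> Ht) (g : K -> Ht) (h : K -> H'),
    matching H m /\ double_pushout string_graph (@ri SR) (@rj SR) m g h.

Definition sg_rewrites (SR : sg_rule) : graph -> graph -> Prop :=
  clos_refl_trans graph (fun H H' => iso H H' \/ sg_apply SR H H').

Lemma pair_irrefl (v : bool) (c : Gamma A) (w : bool) :
  (v, c, w) \in (set0 : {set bool * Gamma A * bool}) -> v != w.
Proof. by rewrite inE. Qed.

Definition pair_graph (n1 n2 : Sigma A) : graph :=
  @Graph bool set0 (fun b => if b then n2 else n1) pair_irrefl.

Lemma edge_irrefl (a : Gamma A) (v : bool) (c : Gamma A) (w : bool) :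
  (v, c, w) \in [set (false, a, true)] -> v != w.
Proof. by rewrite inE => /eqP [-> _ ->]. Qed.

Definition edge_graph (a : Gamma A) (n1 n2 : Sigma A) : graph :=
  @Graph bool [set (false, a, true)] (fun b => if b then n2 else n1)
    (@edge_irrefl a).

Definition pair_to_edge (a : Gamma A) (n1 n2 : Sigma A) :
  pair_graph n1 n2 -> edge_graph a n1 n2 := fun b : bool => b.

(* The rule for (a, n1, n2) is the span
   edge_graph a n1 n2 <- pair_graph n1 n2 -> dec_rhs a n1 n2; the values at
   triples outside Enc * NodeL * NodeL are irrelevant. *)
Record decoding_system := DecodingSystem {
  dec_rhs : Gamma A -> Sigma A -> Sigma A -> graph;
  dec_emb : forall a n1 n2, pair_graph n1 n2 -> dec_rhs a n1 n2;
  dec_ok : forall a n1 n2,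
    a \in Enc A -> n1 \in NodeL A -> n2 \in NodeL A ->
    [/\ is_mono (@dec_emb a n1 n2),
        string_graph (dec_rhs a n1 n2),
        connected (dec_rhs a n1 n2) &
        forall v : dec_rhs a n1 n2, ~~ is_boundary v] }.

Definition decode_step (T : decoding_system) (H H' : graph) : Prop :=
  exists (a : Gamma A) (n1 n2 : Sigma A),
    [/\ a \in Enc A, n1 \in NodeL A, n2 \in NodeL A &
    exists (K : graph) (m : edge_graph a n1 n2 -> H) (g : K -> H) (h : K -> H'),
      is_mono m /\
      double_pushout all_graphs (@pair_to_edge a n1 n2) (@dec_emb T a n1 n2)
        m g h].

Definition decodes (T : decoding_system) (H F : graph) : Prop :=
  clos_refl_trans graph (fun G G' => iso G G' \/ decode_step T G G') H F /\
  no_encoding F.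

Inductive direction := d_in | d_out.

(* inst s b c x d stands for (s, b/c, x, d) \in C. *)
Record emb_graph := EmbGraph {
  body :> graph;
  inst : Sigma A -> Gamma A -> Gamma A -> body -> direction -> bool }.

Definition has_inst (D : emb_graph) (x : D) : Prop :=
  exists s b c d, inst s b c x d.

Record production := Production {
  lhs : Sigma A;
  rhs :> emb_graph }.

Record edNCE := EdNCE {
  term : {set Sigma A};
  final : {set Gamma A};
  pidx : finType;
  prods : pidx -> production;
  start : Sigma A;
  start_nonterminal : start \notin term;
  lhs_nonterminal : forall p, lhs (prods p) \notin term }.

Section Substitution.
Variables (H : graph) (v : H) (D : emb_graph).

Definition subst_vert : finType := ({x : H | x != v} + D)%type.

Definition subst_edge (x : subst_vert) (c : Gamma A) (y : subst_vert) : bool :=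
  match x, y with
  | inl w, inl u => (val w, c, val u) \in edges H
  | inr a, inr b => (a, c, b) \in edges D
  | inl w, inr a =>
      [exists b, ((val w, b, v) \in edges H) && inst (lab (val w)) b c a d_in]
  | inr a, inl w =>
      [exists b, ((v, b, val w) \in edges H) && inst (lab (val w)) b c a d_out]
  end.

Definition subst_lab (x : subst_vert) : Sigma A :=
  match x with inl w => lab (val w) | inr a => lab a end.

Lemma subst_irrefl x c y :
  (x, c, y) \in [set e : subst_vert * Gamma A * subst_vert
                 | subst_edge e.1.1 e.1.2 e.2] -> x != y.
Proof.
rewrite inE /=; case: x y => [x|x] [y|y] //= he.
  exact: edges_irrefl he.
exact: edges_irrefl he.
Qed.

Definition subst_graph : graph := Graph subst_lab subst_irrefl.

End Substitution.

Lemma single_irrefl (v : unit) (c : Gamma A) (w : unit) :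
  (v, c, w) \in (set0 : {set unit * Gamma A * unit}) -> v != w.
Proof. by rewrite inE. Qed.

Definition single_graph (s : Sigma A) : graph :=
  @Graph unit set0 (fun _ => s) single_irrefl.

Definition boundary_edNCE (G : edNCE) : Prop :=
  forall p : pidx G,
    (forall e, e \in edges (prods p) ->
       (lab e.1.1 \in term G) || (lab e.2 \in term G)) /\
    (forall s b c (x : prods p) d, inst s b c x d -> s \in term G).

(* d is relative to y: d_in is an edge from w into y. *)
Definition edge_dir (G : graph) (y w : G) (b : Gamma A) (d : direction) : bool :=
  match d with
  | d_in => (w, b, y) \in edges G
  | d_out => (y, b, w) \in edges G
  end.

Record ESG := Esg {
  grammar :> edNCE;
  decoder : decoding_system }.

Record is_BESG (G : ESG) : Prop := IsBESG {
  besg_term : term G = terminals;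
  besg_final : final G = setT;
  besg_boundary : boundary_edNCE G;
  besg_N1 : forall (p : pidx G) e, e \in edges (prods p) ->
    (e.1.2 \in Enc A) = (is_node e.1.1 && is_node e.2);
  besg_N2 : forall (p : pidx G) s b c (x : prods p) d,
    inst s b c x d -> s \in NodeL A -> is_node x -> c \in Enc A;
  besg_W1 : forall p : pidx G, wire_degrees (prods p);
  besg_W2 : forall (p : pidx G) s b c (x : prods p) d,
    inst s b c x d -> ~~ is_wire x;
  besg_W3 : forall (p : pidx G) w b d, w \in WireL A ->
    (forall c c' (x x' : prods p),
       inst w b c x d -> inst w b c' x' d -> c = c' /\ x = x') /\
    (forall c (x : prods p), inst w b c x d -> c \notin Enc A);
  besg_W4 : forall (p : pidx G) (y : prods p) w b d,
    is_nonterminal y -> w \in WireL A ->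
    (exists2 u : prods p, lab u = w & edge_dir y u b d) \/
    (exists a, inst w a b y d) ->
    forall q : pidx G, lhs (prods q) = lab y ->
    exists c (z : prods q), inst w b c z d }.

(* Vertices of the two bodies are identified along corr_nt, which is part of
   the correspondence. *)
Record correspondence (G1 G2 : edNCE) := Correspondence {
  corr : pidx G1 -> pidx G2;
  corr_bij : bijective corr;
  corr_nt : forall p, prods p -> prods (corr p) -> Prop }.

Definition nt_bijection (G1 G2 : graph) (r : G1 -> G2 -> Prop) : Prop :=
  [/\ forall x y, r x y ->
        [/\ is_nonterminal x, is_nonterminal y & lab x = lab y],
      forall x, is_nonterminal x -> exists! y, r x y &
      forall y, is_nonterminal y -> exists! x, r x y].

Definition equipotent (G1 G2 : graph) (P1 : pred G1) (P2 : pred G2) : Prop :=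
  exists f : {x | P1 x} -> {x | P2 x}, bijective f.

Record rewrite_pattern (B1 B2 : ESG) (c : correspondence B1 B2) : Prop :=
    RewritePattern {
  rp_left : is_BESG B1;
  rp_right : is_BESG B2;
  rp_decoder : decoder B1 = decoder B2;
  rp_start : start B1 = start B2;
  rp_lhs : forall p, lhs (prods (corr c p)) = lhs (prods p);
  rp_NT : forall p, nt_bijection (corr_nt (c := c) (p := p));
  rp_IO : forall p,
    equipotent (@is_input (prods p)) (@is_input (prods (corr c p))) /\
    equipotent (@is_output (prods p)) (@is_output (prods (corr c p))) }.

Definition subst_track (H1 H2 : graph) (v1 : H1) (v2 : H2) (D1 D2 : emb_graph)
    (r : H1 -> H2 -> Prop) (rD : D1 -> D2 -> Prop)
    (x : subst_graph v1 D1) (y : subst_graph v2 D2) : Prop :=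
  match x, y with
  | inl x, inl y => r (val x) (val y)
  | inr x, inr y => rD x y
  | _, _ => False
  end.

(* parallel c r: H1 and H2 are reached by derivations performing the same
   steps, with r the induced identification of their non-terminal vertices. *)
Inductive parallel (G1 G2 : edNCE) (c : correspondence G1 G2) :
    forall H1 H2 : graph, (H1 -> H2 -> Prop) -> Prop :=
| par_start :
    parallel c (H1 := single_graph (start G1)) (H2 := single_graph (start G2))
      (fun _ _ => True)
| par_step (H1 H2 : graph) (r : H1 -> H2 -> Prop) (v1 : H1) (v2 : H2) p :
    parallel c r -> r v1 v2 ->
    lab v1 = lhs (prods p) -> lab v2 = lhs (prods (corr c p)) ->
    parallel c (H1 := subst_graph v1 (prods p))
      (H2 := subst_graph v2 (prods (corr c p)))
      (subst_track r (corr_nt (c := c) (p := p))).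

Definition pattern_instantiation (B1 B2 : ESG) (c : correspondence B1 B2)
    (F1 F2 : graph) : Prop :=
  exists (H1 H2 : graph) (r : H1 -> H2 -> Prop),
    [/\ parallel c r,
        (forall v : H1, lab v \in term B1) /\ (forall v : H2, lab v \in term B2),
        decodes (decoder B1) H1 F1 &
        decodes (decoder B2) H2 F2].

Definition admissible (SR : sg_rule) (B1 B2 : ESG) (c : correspondence B1 B2) :
  Prop :=
  forall F1 F2 : graph, pattern_instantiation c F1 F2 -> sg_rewrites SR F1 F2.

(* A graph with a distinguished subgraph; vertices outside the subgraph carry
   a name in O, so that they can be followed through wire-homeomorphisms of
   the subgraph. *)
Record marked (O : Type) := Marked {
  mgraph :> graph;
  name : mgraph -> option O;
  medges : {set mgraph * Gamma A * mgraph} }.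

Definition in_region (O : Type) (M : marked O) (x : M) : bool :=
  ~~ isSome (name x).

Lemma region_irrefl (O : Type) (M : marked O) x c y :
  (x, c, y) \in [set e : {x : M | in_region x} * Gamma A * {x : M | in_region x}
                 | emap val e \in edges M :&: medges M] -> x != y.
Proof.
by rewrite !inE => /andP [he _]; apply: contra (edges_irrefl he) => /eqP ->.
Qed.

Definition region (O : Type) (M : marked O) : graph :=
  Graph (fun x : {x : M | in_region x} => lab (val x)) (@region_irrefl O M).

Definition mark (D : graph) (SV : {set D}) (SE : {set D * Gamma A * D}) :
  marked D := @Marked D D (fun x => if x \in SV then None else Some x) SE.

Definition marked_iso (O : Type) (M N : marked O) : Prop :=
  exists f : M -> N,
    [/\ is_iso f, forall x, name (f x) = name x &
        forall e, (emap f e \in medges N) = (e \in medges M)].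

Definition split_marked (O : Type) (M : marked O) (w : M) (c : Gamma A) :
  marked O :=
  @Marked O (split_graph w c) (fun x => if x is Some v then name v else None)
    (split_edges w c (medges M)).

Definition marked_split (O : Type) (M N : marked O) : Prop :=
  exists (w : M) (c : Gamma A),
    [/\ in_region w, is_wire w, c \notin Enc A &
        marked_iso (split_marked w c) N].

Definition marked_homeo (O : Type) : marked O -> marked O -> Prop :=
  clos_refl_sym_trans (marked O)
    (fun M N => marked_iso M N \/ marked_split M N).

Definition is_subgraph (D : graph) (SV : {set D}) (SE : {set D * Gamma A * D}) :
  Prop :=
  SE \subset edges D /\ (forall e, e \in SE -> (e.1.1 \in SV) && (e.2 \in SV)).

Definition final_subgraph (D : emb_graph) (SV : {set D})
    (SE : {set D * Gamma A * D}) : Prop :=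
  [/\ is_subgraph SV SE,
      string_graph (region (mark SV SE)),
      forall x y : D, x \in SV -> is_nonterminal y -> ~~ adjacent x y &
      forall x : D, x \in SV -> ~ has_inst x].

(* SR is matched on M, the body of p with its final subgraph replaced by a
   wire-homeomorphic one. The vertices of p outside the final subgraph survive
   in p', which is how p' inherits the connection instructions of p and how
   the non-terminals of the two bodies are identified. *)
Definition rewritten_production (SR : sg_rule) (p p' : production)
    (nt : p -> p' -> Prop) : Prop :=
  lhs p' = lhs p /\
  exists (SV : {set p}) (SE : {set p * Gamma A * p}) (M : marked p) (K : graph)
      (m : rL SR -> region M) (g : K -> M) (h : K -> p'),
    let survives (x : p) (y : p') :=
      exists k : K, name (g k) = Some x /\ h k = y in
    [/\ final_subgraph SV SE,
        marked_homeo (mark SV SE) M,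
        matching (region (mark SV SE)) m,
        double_pushout all_graphs (G := M) (@ri SR) (@rj SR)
          (fun x => val (m x)) g h &
        (forall s b c (y : p') d,
           inst s b c y d <-> exists2 x : p, survives x y & inst s b c x d) /\
        (forall x y, nt x y <-> is_nonterminal x /\ survives x y)].

Inductive same_production (p : production) :
    forall p' : production, (p -> p' -> Prop) -> Prop :=
| SameProduction (nt : p -> p -> Prop) :
    (forall x y, nt x y <-> is_nonterminal x /\ x = y) ->
    same_production (p' := p) nt.

Definition transformation_step (SR : sg_rule) (B B' : ESG)
    (c : correspondence B B') : Prop :=
  [/\ term B' = term B, final B' = final B, start B' = start B,
      decoder B' = decoder B &
      exists p : pidx B,
        rewritten_production SR (corr_nt (c := c) (p := p)) /\
        (forall q, q != p -> same_production (corr_nt (c := c) (p := q)))].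

End Graphs.

(* Main.v *)
From Stdlib Require Import Setoid Relation_Operators.
From mathcomp Require Import all_boot.
Require Import Defs.

Set Implicit Arguments.
Unset Strict Implicit.
Unset Printing Implicit Defensive.

(** A pushout of monomorphisms is a concrete gluing, so the dangling condition
    of the double pushout forces every edge at a matched non-boundary vertex to
    be an edge of [L].  Hence the rewritten part of the body of [p] carries no
    encoding edge, no connection instruction and no non-terminal neighbour: it
    is a plug that the context only meets at named vertices.  Replacing the
    plug [D] by [D'] therefore commutes with every later substitution and every
    decoding step, and two parallel derivations end in graphs that differ by
    finitely many such replacements, one for each use of [p].  Decoding is
    confluent (two decodings of distinct edges commute), so [F'] is the graph
    reached from [F] by the replacements that survive decoding.  Finally the
    wire-homeomorphism and the double pushout used on the body can be performed
    inside any context, so on string graphs each replacement is one application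
    of [SR]. *)

(** * Isomorphisms, degrees and wire splitting *)

(** The plug cannot be the whole final subgraph. Only the chosen edges of that subgraph form a
    string graph, so an unmatched node-vertex in it may still carry encoding edges and be touched by
    decoding. The plug therefore consists of the wires of the final subgraph, which
    wire-homeomorphisms create and destroy, and of the matched vertices. All other vertices get
    names, and these have to be followed through the wire-homeomorphism, which changes the vertex
    set. A second obstacle is the change of category: the body is rewritten by pushouts among all
    graphs, since it has non-terminals and encoding edges, whereas [SR] acts on decoded graphs by
    pushouts among string graphs. The elementwise notion [is_gluing] is deduced from the former and
    yields the latter. Graphs met during a derivation are not string graphs, so wire degrees and
    exactness of encoding labels are carried as separate invariants. The string graph property is
    reached for the decoded graph of [B] and then passed along the replacements. *)

Section Isomorphisms.

Variable A : alphabets.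
Implicit Types G H : graph A.

Lemma inj_surj_bij (U V : finType) (f : U -> V) :
  injective f -> (forall y, exists x, f x = y) -> bijective f.
Proof.
move=> inj_f /fin_all_exists [g gK].
by exists g => // x; apply: inj_f; rewrite gK.
Qed.

Lemma is_isoI G H (f : G -> H) :
  injective f -> (forall y, exists x, f x = y) ->
  (forall v, lab (f v) = lab v) ->
  (forall x c y, ((f x, c, f y) \in edges H) = ((x, c, y) \in edges G)) ->
  is_iso f.
Proof.
move=> inj_f surj_f lab_f edge_f; split=> //; first exact: inj_surj_bij.
by case=> [[x c] y]; apply: edge_f.
Qed.

Lemma is_iso_edge G H (f : G -> H) x c y :
  is_iso f -> ((f x, c, f y) \in edges H) = ((x, c, y) \in edges G).
Proof. by case=> _ _ /(_ (x, c, y)). Qed.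

Lemma is_iso_inj G H (f : G -> H) : is_iso f -> injective f.
Proof. by case=> /bij_inj. Qed.

Lemma is_iso_id G : is_iso (id : G -> G).
Proof. by split=> [||[[]]] //; exists id. Qed.

Lemma is_iso_comp G1 G2 G3 (f : G1 -> G2) (g : G2 -> G3) :
  is_iso f -> is_iso g -> is_iso (g \o f).
Proof.
move=> [bf lf ef] [bg lg eg]; split; first exact: bij_comp.
  by move=> v; rewrite /= lg lf.
by move=> e; rewrite -ef -eg.
Qed.

Lemma is_iso_inv G H (f : G -> H) :
  is_iso f -> exists g : H -> G, [/\ is_iso g, cancel f g & cancel g f].
Proof.
case=> [[g fK gK] lf ef]; exists g; split=> //; split=> [|v|[[x c] y]].
- by exists f.
- by rewrite -lf gK.
by rewrite -ef /emap /= !gK.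
Qed.

Lemma iso_refl G : iso G G.
Proof. exists id; exact: is_iso_id. Qed.

Lemma iso_sym G H : iso G H -> iso H G.
Proof. by case=> f /is_iso_inv [g [g_iso _ _]]; exists g. Qed.

Lemma iso_trans G1 G2 G3 : iso G1 G2 -> iso G2 G3 -> iso G1 G3.
Proof. by move=> [f f_iso] [g g_iso]; exists (g \o f); apply: is_iso_comp. Qed.

End Isomorphisms.

Section Degrees.

Variable A : alphabets.
Implicit Types G H : graph A.

Definition deg G (d : direction) (v : G) : nat :=
  if d is d_in then indeg v else outdeg v.

Definition is_end G (d : direction) (v : G) : bool :=
  is_wire v && (deg d v == 0).

Lemma deg_le1P G d (v : G) :
  deg d v <= 1 <->
  (forall w b w' b', edge_dir v w b d -> edge_dir v w' b' d ->
     w = w' /\ b = b').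
Proof.
split.
  case: d => /card_le1_eqP one w b w' b' /= e1 e2.
    have E : (w', b', v) = (w, b, v) by apply: one; rewrite inE ?e1 ?e2 /= eqxx.
    by case: E => -> ->.
  have E : (v, b', w') = (v, b, w) by apply: one; rewrite inE ?e1 ?e2 /= eqxx.
  by case: E => -> ->.
case: d => /= one; apply/card_le1_eqP=> -[[a b] c] [[a' b'] c'];
    rewrite !inE /= => /andP [e1 /eqP E1] /andP [e2 /eqP E2]; subst.
  by have [-> ->] := one _ _ _ _ e1 e2.
by have [-> ->] := one _ _ _ _ e1 e2.
Qed.

Lemma deg_eq0P G d (v : G) :
  reflect (forall w b, ~~ edge_dir v w b d) (deg d v == 0).
Proof.
apply: (iffP idP).
  case: d => /=; rewrite cards_eq0 => /eqP deg0 w b; apply/negP=> e.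
    by move/setP/(_ (w, b, v)): deg0; rewrite !inE e eqxx.
  by move/setP/(_ (v, b, w)): deg0; rewrite !inE e eqxx.
case: d => /= no_edge; rewrite cards_eq0; apply/eqP/setP=> -[[a b] c];
    rewrite !inE /=; apply/negP=> /andP [e /eqP E]; subst.
  by move: (no_edge a b); rewrite e.
by move: (no_edge c b); rewrite e.
Qed.

(** A cardinal-free form of [wire_degrees], which passes directly through injective homomorphisms
    and case analyses on edges. *)
Definition wire_functional G : Prop :=
  forall (v : G) d w b w' b', is_wire v ->
    edge_dir v w b d -> edge_dir v w' b' d -> w = w' /\ b = b'.

Definition enc_exact G : Prop :=
  forall (x : G) c y, (x, c, y) \in edges G ->
    (c \in Enc A) = is_node x && is_node y.

Definition all_terminal G : Prop := forall v : G, lab v \in terminals A.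

Lemma wire_functionalP G : wire_degrees G <-> wire_functional G.
Proof.
split=> [deg_ok v d w b w' b' wire_v|fun_ok v wire_v].
  have [deg_in deg_out] := deg_ok v wire_v.
  by apply: (proj1 (deg_le1P d v)); case: d.
by split; [apply/(deg_le1P d_in)|apply/(deg_le1P d_out)] => w b w' b';
  apply: fun_ok.
Qed.

(** Without encoding labels, [enc_exact] amounts to the absence of edges between node-vertices. The
    conditions are separated this way because all but [no_encoding] make sense for encoded string
    graphs, before decoding. *)
Lemma string_graphP G :
  string_graph G <->
  [/\ all_terminal G, wire_functional G, enc_exact G & no_encoding G].
Proof.
split=> [[term_G node_G /wire_functionalP wire_G enc_G]|].
  split=> // x c y e.
  by rewrite (negPf (enc_G _ e)) (negPf (node_G _ e)).
case=> term_G /wire_functionalP wire_G exact_G enc_G; split=> //.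
by case=> [[x c] y] /= e; rewrite -(exact_G _ _ _ e) (enc_G _ e).
Qed.

Lemma edge_dir_iso G H (f : G -> H) y w b d :
  is_iso f -> edge_dir (f y) (f w) b d = edge_dir y w b d.
Proof. by move=> f_iso; case: d; rewrite /= is_iso_edge. Qed.

Lemma wire_functional_iso G H : iso G H -> wire_functional H -> wire_functional G.
Proof.
case=> f f_iso wf v d w b w' b' wire_v e1 e2.
have [//|||/(is_iso_inj f_iso) -> ->] // := wf (f v) d (f w) b (f w') b'.
- by rewrite /is_wire; case: f_iso => _ ->.
- by rewrite edge_dir_iso.
- by rewrite edge_dir_iso.
Qed.

Lemma enc_exact_iso G H : iso G H -> enc_exact H -> enc_exact G.
Proof.
case=> f f_iso ex x c y e.
rewrite (ex (f x) c (f y)) ?is_iso_edge // /is_node.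
by case: f_iso => _ lf _; rewrite !lf.
Qed.

Lemma all_terminal_iso G H : iso G H -> all_terminal H -> all_terminal G.
Proof. by case=> f [_ lf _] t v; rewrite -lf. Qed.

Lemma no_encoding_iso G H : iso G H -> no_encoding H -> no_encoding G.
Proof.
by case=> f [_ _ ef] ne e e_in; have := ne (emap f e); rewrite ef => /(_ e_in).
Qed.

Lemma string_graph_iso G H : iso G H -> string_graph H -> string_graph G.
Proof.
move=> gh /string_graphP [t w x n]; apply/string_graphP; split.
- exact: all_terminal_iso gh t.
- exact: wire_functional_iso gh w.
- exact: enc_exact_iso gh x.
exact: no_encoding_iso gh n.
Qed.

Lemma is_end_iso G H (f : G -> H) d v :
  is_iso f -> is_end d (f v) = is_end d v.
Proof.
move=> f_iso; rewrite /is_end /is_wire; case: (f_iso) => bf -> _; congr (_ && _).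
apply/deg_eq0P/deg_eq0P=> [h w b|h w b].
  by rewrite -(edge_dir_iso _ _ _ _ f_iso).
by case: bf => g fK gK; rewrite -(gK w) (edge_dir_iso _ _ _ _ f_iso).
Qed.

Lemma card_is_end_iso G H d : iso G H -> #|@is_end G d| = #|@is_end H d|.
Proof.
case=> f f_iso; have inj_f := is_iso_inj f_iso.
rewrite -(card_imset _ inj_f); apply: eq_card => y.
have [g [_ fK gK]] := is_iso_inv f_iso.
rewrite -[y]gK mem_imset //.
by rewrite [RHS](is_end_iso _ _ f_iso).
Qed.

(** * Splitting a wire-vertex: string graph conditions and numbers of ends *)

Section Split.

Variables (G : graph A) (w : G) (c : Gamma A).

Lemma split_edgesE (s : {set G * Gamma A * G}) x d y :
  ((x, d, y) \in split_edges w c s) =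
  match x, y with
  | Some x, Some y => (x != w) && ((x, d, y) \in s)
  | None, Some y => (w, d, y) \in s
  | Some x, None => (x == w) && (d == c)
  | None, None => false
  end.
Proof.
rewrite !inE; case: x y => [x|] [y|]; rewrite !xpair_eqE ?andbF ?andbT //=.
- apply/imsetP/andP => [[[[a b] e] ain]|[xw xin]].
    by rewrite /split_edge /split_src /=; case: eqP => // /eqP ? [-> -> ->].
  by exists (x, d, y) => //; rewrite /split_edge /split_src /= (negPf xw).
- apply/orP/idP; last by move=> h; left.
  by case=> // /imsetP [[[a b] e] _].
- apply/imsetP/idP => [[[[a b] e] ain]|xin].
    by rewrite /split_edge /split_src /=; case: eqP => // <- [-> ->].
  by exists (w, d, y) => //; rewrite /split_edge /split_src /= eqxx.
by apply/imsetP=> -[[[a b] e] _].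
Qed.

Hypothesis wire_w : is_wire w.
Hypothesis enc_c : c \notin Enc A.

Let S : graph A := split_graph w c.

Lemma split_wire (x : S) : is_wire x = if x is Some v then is_wire v else true.
Proof. by case: x. Qed.

Lemma split_node (x : S) : is_node x = if x is Some v then is_node v else false.
Proof.
case: x => //=; apply/negbTE/negP=> node_w.
by have /disjointFr/(_ node_w) := node_wire_disjoint A; rewrite [_ \in _]wire_w.
Qed.

Lemma split_edgeE (x : S) d (y : S) :
  ((x, d, y) \in edges S) =
  match x, y with
  | Some x, Some y => (x != w) && ((x, d, y) \in edges G)
  | None, Some y => (w, d, y) \in edges G
  | Some x, None => (x == w) && (d == c)
  | None, None => false
  end.
Proof. exact: split_edgesE. Qed.

Lemma all_terminal_split : all_terminal S <-> all_terminal G.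
Proof.
split=> t v; first exact: (t (Some v)).
by case: v => [v|]; apply: t.
Qed.

Lemma no_encoding_split : no_encoding S <-> no_encoding G.
Proof.
split=> ne [[x d] y] e /=.
  have [E|xw] := eqVneq x w.
    by apply: (ne (None, d, Some y)); rewrite split_edgeE -E.
  by apply: (ne (Some x, d, Some y)); rewrite split_edgeE xw.
move: e; rewrite split_edgeE; case: x y => [x|] [y|] //.
- by case/andP=> _ /ne.
- by case/andP=> _ /eqP ->.
- by move/ne.
Qed.

Lemma node_split_w : is_node w = false.
Proof. by have := split_node (None : S). Qed.

Lemma enc_exact_split : enc_exact S <-> enc_exact G.
Proof.
split=> ex x d y e.
  have [E|xw] := eqVneq x w.
    have := ex None d (Some y); rewrite split_edgeE -E => /(_ e) ->.
    by rewrite !split_node E node_split_w.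
  by have := ex (Some x) d (Some y); rewrite split_edgeE xw => /(_ e) ->.
move: e; rewrite split_edgeE !split_node; case: x y => [x|] [y|] //=.
- by case/andP=> _ /ex.
- by case/andP=> _ /eqP ->; rewrite andbF (negPf enc_c).
- by move/ex ->; rewrite node_split_w.
Qed.

(** The new edge is the only one leaving [Some w] and the only one entering [None]; the old edges at
    [w] are shared out between the two halves by direction. *)
Lemma wire_functional_split : wire_functional S <-> wire_functional G.
Proof.
split=> wf.
  (* The copy in [S] of an edge of [G]: its target is kept as [Some], and its source becomes [None]
     exactly when it was [w]. *)
  have lift v u b d : edge_dir v u b d ->
      let s x := if x == w then None else Some x in
      @edge_dir _ S (if d is d_in then Some v else s v)
                    (if d is d_in then s u else Some u) b d.
    by case: d => /= e; case: eqVneq => [E|E]; rewrite split_edgeE -?E ?E ?e //=;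
       rewrite -?E.
  move=> v d u b u' b' wire_v /lift e1 /lift e2.
  have := wf _ _ _ _ _ _ _ e1 e2; case: d {e1 e2} => /=.
    case/(_ wire_v) => E <-; split=> //; move: E.
    by case: eqP => [->|_]; case: eqP => [->|_] // [].
  by case: eqP => _ h; have [//|[->] ->] := h _.
move=> [v|] [] [u|] b [u'|] b' wire_v; rewrite /= !split_edgeE //.
- by case/andP=> _ e1 /andP [_ e2]; have [-> ->] := wf v d_in _ _ _ _ wire_v e1 e2.
- by case/andP=> uw e1 e2; have [E] := wf v d_in _ _ _ _ wire_v e1 e2;
    rewrite E eqxx in uw.
- by move=> e1 /andP [uw e2]; have [E] := wf v d_in _ _ _ _ wire_v e1 e2;
    rewrite -E eqxx in uw.
- by move=> e1 e2; have [_ ->] := wf v d_in _ _ _ _ wire_v e1 e2.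
- by case/andP=> _ e1 /andP [_ e2]; have [-> ->] := wf v d_out _ _ _ _ wire_v e1 e2.
- by case/andP=> /negPf ->.
- by case/andP=> /eqP ->; rewrite eqxx.
- by case/andP=> _ /eqP -> /andP [_ /eqP ->].
- by case/andP=> /eqP -> /eqP -> /andP [/eqP -> /eqP ->].
- by move=> e1 e2; have [-> ->] := wf w d_out _ _ _ _ wire_w e1 e2.
Qed.

Lemma string_graph_split : string_graph S <-> string_graph G.
Proof.
rewrite !string_graphP.
have [t1 t2] := all_terminal_split; have [w1 w2] := wire_functional_split.
have [e1 e2] := enc_exact_split; have [n1 n2] := no_encoding_split.
by split=> -[? ? ? ?]; split; auto.
Qed.

(** The map [f] sends [w] to the half that inherits its edges of direction [d]: [Some w] for inputs,
    [None] for outputs. The other half meets the new edge in that direction, so it is never an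
    end. *)
Lemma card_is_end_split d : #|@is_end S d| = #|@is_end G d|.
Proof.
pose f (v : G) : S := if d is d_in then Some v else
  if v == w then None else Some v.
have inj_f : injective f.
  move=> x y; rewrite /f; case: (d); first by case.
  by case: eqP => [->|_]; case: eqP => [->|_] // [].
have fE v : is_end d (f v) = is_end d v.
  rewrite /is_end /f; case: (d).
    rewrite split_wire; congr (_ && _); apply/deg_eq0P/deg_eq0P => /= h u b.
      have [E|uw] := eqVneq u w.
        by have := h None b; rewrite split_edgeE E.
      by have := h (Some u) b; rewrite split_edgeE uw.
    case: u => [u|]; rewrite split_edgeE //.
    by rewrite negb_and h orbT.
  case: eqVneq => [->|vw]; rewrite split_wire ?wire_w; congr (_ && _);
      apply/deg_eq0P/deg_eq0P => /= h u b.
  - by have := h (Some u) b; rewrite split_edgeE.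
  - by case: u => [u|]; rewrite split_edgeE.
  - by have := h (Some u) b; rewrite split_edgeE vw.
  - by case: u => [u|]; rewrite split_edgeE ?vw //= (negPf vw).
rewrite -(card_imset _ inj_f); apply: eq_card => y; rewrite unfold_in.
apply/idP/imsetP=> [end_y|[x end_x ->]];
  last by rewrite -[_ && _]/(is_end d (f x)) fE.
have [x E] : exists x, y = f x.
  move: end_y; rewrite /f /is_end; case: (d).
    case: y => [y _|/andP [_ /deg_eq0P /(_ (Some w) c)]]; first by exists y.
    by rewrite /= split_edgeE !eqxx.
  case: y => [y|_]; last by exists w; rewrite eqxx.
  case/andP=> _ /deg_eq0P /(_ None c); rewrite /= split_edgeE eqxx andbT => yw.
  by exists y; rewrite (negPf yw).
by exists x => //; move: end_y; rewrite E -[_ && _]/(is_end d (f x)) fE.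
Qed.

End Split.

Lemma wire_homeo_inv (P : graph A -> Prop) :
  (forall G H, iso G H -> P H -> P G) ->
  (forall G (w : G) c, is_wire w -> c \notin Enc A ->
     P (split_graph w c) <-> P G) ->
  forall G H, wire_homeo G H -> P G <-> P H.
Proof.
move=> P_iso P_split G H; elim=> {G H}.
- move=> G H [gh|[w [c [wire_w enc_c gh]]]].
    by split; apply: P_iso => //; apply: iso_sym.
  rewrite -(P_split G w c) //.
  by split; apply: P_iso => //; apply: iso_sym.
- by [].
- by move=> G H _ ->.
- by move=> G H F _ -> _ ->.
Qed.

Lemma string_graph_homeo G H : wire_homeo G H -> string_graph G <-> string_graph H.
Proof.
apply: wire_homeo_inv; first exact: string_graph_iso.
by move=> F w c wire_w enc_c; apply: string_graph_split.
Qed.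

Lemma wire_functional_homeo G H :
  wire_homeo G H -> wire_functional G <-> wire_functional H.
Proof.
apply: wire_homeo_inv; first exact: wire_functional_iso.
by move=> F w c wire_w enc_c; apply: wire_functional_split.
Qed.

Lemma enc_exact_homeo G H : wire_homeo G H -> enc_exact G <-> enc_exact H.
Proof.
apply: wire_homeo_inv; first exact: enc_exact_iso.
by move=> F w c wire_w enc_c; apply: enc_exact_split.
Qed.

Lemma card_is_end_homeo G H d :
  wire_homeo G H -> #|@is_end G d| = #|@is_end H d|.
Proof.
move=> gh; apply/esym; pose P F := #|@is_end F d| = #|@is_end G d|.
apply: (proj1 (wire_homeo_inv (P := P) _ _ gh)) => // [F F'|F w c wire_w enc_c].
  by move/(card_is_end_iso d); rewrite /P => ->.
by rewrite /P card_is_end_split.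
Qed.

End Degrees.

(** * Gluings and double pushouts *)

Section Gluing.

Variable A : alphabets.

Section Square.

Variables (I L K G : graph A).
Variables (i : I -> L) (k : I -> K) (m : L -> G) (g : K -> G).

(** A pushout of monomorphisms seen elementwise: two embedded graphs cover [G] and overlap, on
    vertices, in the image of [I]. No class of graphs occurs here, which allows a change of ambient
    category. *)
Record is_gluing : Prop := IsGluing {
  gluing_l : is_mono m;
  gluing_r : is_mono g;
  gluing_comm : forall b, m (i b) = g (k b);
  gluing_cover : forall v, (exists x, v = m x) \/ (exists y, v = g y);
  gluing_meet : forall x y, m x = g y -> exists b, x = i b /\ y = k b;
  gluing_edges : forall e, e \in edges G ->
    (exists2 e', e' \in edges L & e = emap m e') \/
    (exists2 e', e' \in edges K & e = emap g e') }.

Lemma gluing_pushout (C : graph A -> Prop) :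
  [/\ C I, C L, C K & C G] -> is_hom i -> is_hom k -> is_gluing ->
  is_pushout C i k m g.
Proof.
move=> CG hom_i hom_k [[hom_m inj_m] [hom_g inj_g] comm cover meet edge].
split=> // X a b CX hom_a hom_b ab.
(* Both prescriptions are imposed on the value at [v] at once; on the overlap they agree by [meet]
   and [ab]. *)
have /fin_all_exists [u uP] (v : G) : exists w : X,
    (forall x, m x = v -> w = a x) /\ (forall y, g y = v -> w = b y).
  have [[x ->]|[y ->]] := cover v.
    exists (a x); split=> [x' /inj_m ->|y /esym /meet [z [-> ->]]] //.
  by exists (b y); split=> [x' /meet [z [-> ->]]|y' /inj_g ->].
have um x : u (m x) = a x by case: (uP (m x)) => h _; apply: h.
have ug y : u (g y) = b y by case: (uP (g y)) => _ h; apply: h.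
exists u; split=> //.
  split=> [v|e].
    have [[x ->]|[y ->]] := cover v.
      by rewrite um; case: hom_a => ->; case: hom_m => ->.
    by rewrite ug; case: hom_b => ->; case: hom_g => ->.
  case/edge => -[[[x c] y] e' ->]; rewrite /emap /= ?um ?ug.
    by case: hom_a => _ /(_ _ e').
  by case: hom_b => _ /(_ _ e').
move=> u' _ u'm u'g v; have [[x ->]|[y ->]] := cover v.
  by rewrite um; apply: u'm.
by rewrite ug; apply: u'g.
Qed.

(* [pushout_vert] with the edges coming from L and K is the pushout of the
   underlying edge-labelled graphs; it has no loop because it maps to the
   loop-free graph G, so it satisfies the universal property against G. *)
Lemma pushout_gluing :
  injective i -> injective k -> is_pushout (@all_graphs A) i k m g -> is_gluing.
Proof.
move=> inj_i inj_k [_ [hom_i hom_k hom_m hom_g] comm univ].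
pose pushout_vert : finType := ({x : L | x \notin codom i} + K)%type.
pose u0 (x : pushout_vert) : G :=
  match x with inl x => m (val x) | inr y => g y end.
(* The leg from [L]: an interface vertex goes to its copy in [K], any other vertex to itself. *)
have /fin_all_exists [pL pLP] (x : L) : exists y : pushout_vert,
    (forall b, x = i b -> y = inr (k b)) /\
    (forall z, y = inl z -> x = val z) /\
    (forall z, y = inr z -> exists2 b, x = i b & z = k b).
  have [/codomP [b ->]|nx] := boolP (x \in codom i).
    exists (inr (k b)); split=> [b' /inj_i ->|] //; split=> // z [<-].
    by exists b.
  exists (inl (exist _ x nx)); split=> [b E|].
    by case/negP: (nx); rewrite E codom_f.
  by split=> // z [<-].
pose pK (y : K) : pushout_vert := inr y.
have u0L x : u0 (pL x) = m x.
  case E: (pL x) => [z|z] /=; case: (pLP x) => _ [].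
    by move=> /(_ _ E) ->.
  by move=> _ /(_ _ E) [b -> ->]; rewrite comm.
pose eP : {set pushout_vert * Gamma A * pushout_vert} :=
  [set emap pL e | e in edges L] :|: [set emap pK e | e in edges K].
have u0_edge e : e \in eP -> emap u0 e \in edges G.
  rewrite inE => /orP [] /imsetP [[[x c] y] e' ->]; rewrite /emap /= ?u0L.
    by case: hom_m => _ /(_ _ e').
  by case: hom_g => _ /(_ _ e').
have eP_irrefl v c w : (v, c, w) \in eP -> v != w.
  by move/u0_edge/edges_irrefl; apply: contra => /eqP ->.
pose labP (x : pushout_vert) :=
  match x with inl x => lab (val x) | inr y => lab y end.
pose P : graph A := @Graph A pushout_vert eP labP eP_irrefl.
have hom_pL : is_hom (pL : L -> P).
  split=> [x|e e_in]; last by rewrite inE imset_f.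
  case E: (pL x) => [z|z] /=; case: (pLP x) => _ [].
    by move=> /(_ _ E) ->.
  by move=> _ /(_ _ E) [b -> ->]; case: hom_i => ->; case: hom_k => ->.
have hom_pK : is_hom (pK : K -> P).
  by split=> // e e_in; rewrite inE imset_f ?orbT.
have pLK b : pL (i b) = pK (k b) by case: (pLP (i b)) => /(_ b erefl).
have [u [hom_u um ug _]] := univ P pL pK Logic.I hom_pL hom_pK pLK.
have [u1 [_ _ _ u1P]] := univ G m g Logic.I hom_m hom_g comm.
have hom_u0 : is_hom (u0 : P -> G).
  split=> [[x|y]|e] /=; last exact: u0_edge.
    by case: hom_m => ->.
  by case: hom_g => ->.
(* The identity and [u0 \o u] both mediate from [G] to itself, so they agree by uniqueness. The
   properties of the explicit pushout then pass to [G] through [u]. *)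
have uK v : u0 (u v) = v.
  have E1 : (id : G -> G) =1 u1 by apply: u1P => //; split=> // -[[]].
  have E2 : u0 \o u =1 u1.
    apply: u1P => [|x|y] /=.
    - case: hom_u => lu eu; case: hom_u0 => lu0 eu0.
      by split=> [x|e /eu /eu0 //]; rewrite /= lu0 lu.
    - by rewrite [u (m x)]um.
    - by rewrite [u (g y)]ug.
  by have := E2 v; rewrite -(E1 v).
split=> //.
- split=> // x y E.
  have {}E : pL x = pL y by rewrite -[pL x]um -[pL y]um /= E.
  case Ey: (pL y) => [z|z]; move: E; rewrite Ey => Ex.
    by case: (pLP x) => _ [/(_ _ Ex) -> _]; case: (pLP y) => _ [/(_ _ Ey) ->].
  case: (pLP x) => _ [_ /(_ _ Ex) [b -> Eb]].
  case: (pLP y) => _ [_ /(_ _ Ey) [b' ->]].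
  by rewrite Eb => /inj_k ->.
- split=> // x y E.
  have : pK x = pK y by rewrite -[pK x]ug -[pK y]ug /= E.
  by case.
- move=> v; rewrite -[v]uK; case: (u v) => [x|y] /=; first by left; exists (val x).
  by right; exists y.
- move=> x y E.
  have {}E : pL x = inr y by rewrite -[pL x]um /= E; exact: ug.
  by case: (pLP x) => _ [_ /(_ _ E) [b -> ->]]; exists b.
- case=> [[x c] y] e; case: hom_u => _ /(_ _ e).
  rewrite inE => /orP [] /imsetP [[[x' c'] y'] e' [Ex Ec Ey]].
    left; exists (x', c', y') => //.
    by rewrite /emap /= -[x]uK -[y]uK Ex Ey Ec !u0L.
  right; exists (x', c', y') => //.
  by rewrite /emap /= -[x]uK -[y]uK Ex Ey Ec.
Qed.

End Square.

Lemma hom_edge (G H : graph A) (f : G -> H) x c y :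
  is_hom f -> (x, c, y) \in edges G -> (f x, c, f y) \in edges H.
Proof. by case=> _ h /h. Qed.

Lemma hom_edge_dir (G H : graph A) (f : G -> H) y w b d :
  is_hom f -> edge_dir y w b d -> edge_dir (f y) (f w) b d.
Proof. by move=> hom_f; case: d; apply: hom_edge. Qed.

Lemma hom_node (G H : graph A) (f : G -> H) x :
  is_hom f -> is_node (f x) = is_node x.
Proof. by case=> lf _; rewrite /is_node lf. Qed.

Lemma hom_wire (G H : graph A) (f : G -> H) x :
  is_hom f -> is_wire (f x) = is_wire x.
Proof. by case=> lf _; rewrite /is_wire lf. Qed.

Lemma wire_functional_mono (G H : graph A) (f : G -> H) :
  is_mono f -> wire_functional H -> wire_functional G.
Proof.
move=> [hom_f inj_f] wf v d w b w' b' wire_v e1 e2.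
have [|||/inj_f -> ->] // := wf (f v) d (f w) b (f w') b'.
- by rewrite hom_wire.
- exact: hom_edge_dir.
- exact: hom_edge_dir.
Qed.

Lemma enc_exact_mono (G H : graph A) (f : G -> H) :
  is_mono f -> enc_exact H -> enc_exact G.
Proof.
move=> [hom_f inj_f] ex x c y e.
by rewrite (ex _ _ _ (hom_edge hom_f e)) !hom_node.
Qed.

Lemma string_graph_mono (G H : graph A) (f : G -> H) :
  is_mono f -> string_graph H -> string_graph G.
Proof.
move=> mono_f /string_graphP [t w x n]; apply/string_graphP; split.
- by move=> v; case: mono_f => -[lf _] _; rewrite -lf.
- exact: wire_functional_mono mono_f w.
- exact: enc_exact_mono mono_f x.
- by case: mono_f => -[_ ef] _ e /ef /n.
Qed.

Lemma discrete_hom (G H : graph A) (f : G -> H) :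
  edges G = set0 -> (forall v, lab (f v) = lab v) -> is_hom f.
Proof. by move=> disc lf; split=> // e; rewrite disc inE. Qed.

Section Ends.

Variables (I L K G : graph A).
Variables (i : I -> L) (k : I -> K) (m : L -> G) (g : K -> G).
Hypothesis glue : is_gluing i k m g.

Lemma gluing_edge_dir v w b d : edge_dir v w b d ->
  (exists x y, [/\ v = m x, w = m y & edge_dir x y b d]) \/
  (exists x y, [/\ v = g x, w = g y & edge_dir x y b d]).
Proof.
case: d => /= /(gluing_edges glue) [] [[[x c] y] e [-> -> ->]].
- by left; exists y, x.
- by right; exists y, x.
- by left; exists x, y.
- by right; exists x, y.
Qed.

(** Since the ends of [L] lie on the interface, every end of [G] comes from [K]. The count thus
    depends on [L] only through which interface vertices are ends, and can be compared with the one
    for [R] over the same [K]. *)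
Lemma card_is_end_gluing d :
  (forall x : L, is_end d x -> exists b, i b = x) ->
  #|@is_end A G d| = #|[pred y : K | is_end d y &&
    [forall b, (k b == y) ==> is_end d (i b)]]|.
Proof.
have [hom_m inj_m] := gluing_l glue; have [hom_g inj_g] := gluing_r glue.
move=> bd; rewrite -(card_imset _ inj_g); apply: eq_card => v;
  rewrite [LHS]unfold_in.
apply/idP/imsetP.
  case/andP=> wire_v /deg_eq0P no_v.
  have L_end x : v = m x -> is_end d x.
    move=> E; rewrite /is_end -(hom_wire _ hom_m) -E wire_v.
    apply/deg_eq0P=> w b; apply/negP=> /(hom_edge_dir hom_m).
    by rewrite -E (negPf (no_v _ _)).
  have [y E] : exists y, v = g y.
    have [[x E]|//] := gluing_cover glue v.
    have [b Eb] := bd _ (L_end _ E).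
    by exists (k b); rewrite E -Eb (gluing_comm glue).
  exists y => //; rewrite inE /is_end -(hom_wire _ hom_g) -E wire_v /=.
  apply/andP; split.
    apply/deg_eq0P=> w b; apply/negP=> /(hom_edge_dir hom_g).
    by rewrite -E (negPf (no_v _ _)).
  apply/forallP=> b; apply/implyP=> /eqP Eb; apply: L_end.
  by rewrite E -Eb (gluing_comm glue).
case=> y; rewrite inE => /andP [/andP [wire_y /deg_eq0P no_y] /forallP end_y] ->.
rewrite -[_ && _]/(is_end d (g y)) /is_end hom_wire // wire_y.
apply/deg_eq0P=> w b; apply/negP=> /gluing_edge_dir [] [x [z [E _ e]]].
  have [b' [Ex Ey]] := gluing_meet glue (esym E).
  move/implyP: (end_y b'); rewrite Ey eqxx => /(_ isT) /andP [_ /deg_eq0P].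
  by move=> /(_ z b); rewrite -Ex e.
by move/inj_g: E e => <-; rewrite (negPf (no_y _ _)).
Qed.

End Ends.

(** * Invariants of exchanging [L] for [R] along a gluing *)

Section Replacement.

Variables (SR : sg_rule A) (K G H : graph A).
Variables (k : rI SR -> K) (m : rL SR -> G) (g : K -> G).
Variables (n : rR SR -> H) (h : K -> H).
Hypothesis glueG : is_gluing (@ri A SR) k m g.
Hypothesis glueH : is_gluing (@rj A SR) k n h.
Hypothesis disj : forall e e', e \in edges (rL SR) -> e' \in edges K ->
  emap m e <> emap g e'.

Lemma rule_is_end d b : is_end d (@ri A SR b) = is_end d (@rj A SR b).
Proof. by case: d; [apply: r_inputs|apply: r_outputs]. Qed.

Lemma rule_L_end d (x : rL SR) : is_end d x -> exists b, @ri A SR b = x.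
Proof.
by move=> end_x; apply/ri_boundary/orP; case: d end_x; [left|right].
Qed.

Lemma rule_R_end d (x : rR SR) : is_end d x -> exists b, @rj A SR b = x.
Proof.
by move=> end_x; apply/rj_boundary/orP; case: d end_x; [left|right].
Qed.

Lemma all_terminal_replace : all_terminal G -> all_terminal H.
Proof.
move=> tG v; have [[x ->]|[y ->]] := gluing_cover glueH v.
  case: (gluing_l glueH) => -[-> _] _.
  by have /string_graphP [t _ _ _] := rR_string SR; apply: t.
case: (gluing_r glueH) => -[-> _] _.
by case: (gluing_r glueG) => -[<- _] _.
Qed.

Lemma no_encoding_replace : no_encoding G -> no_encoding H.
Proof.
move=> nG e /(gluing_edges glueH) [] [e' e'_in ->].
  by have /string_graphP [_ _ _] := rR_string SR; apply.
by case: (gluing_r glueG) => -[_ /(_ _ e'_in) /nG].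
Qed.

Lemma enc_exact_replace : enc_exact G -> enc_exact H.
Proof.
move=> eG x c y /(gluing_edges glueH) [] [[[x' c'] y'] e [-> -> ->]].
  rewrite !(hom_node _ (proj1 (gluing_l glueH))).
  by have /string_graphP [_ _ ex _] := rR_string SR; apply: ex.
rewrite !(hom_node _ (proj1 (gluing_r glueH))).
exact: (enc_exact_mono (gluing_r glueG) eG).
Qed.

(* At an interface wire, L and R use the same directions, so that R has an
   edge there only in a direction in which K has none. *)
Lemma wire_functional_replace : wire_functional G -> wire_functional H.
Proof.
move=> wG.
have [hom_n inj_n] := gluing_l glueH; have [hom_h inj_h] := gluing_r glueH.
have [hom_m inj_m] := gluing_l glueG; have [hom_g inj_g] := gluing_r glueG.
have wK := wire_functional_mono (gluing_r glueG) wG.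
have wR : wire_functional (rR SR).
  by have /string_graphP [] := rR_string SR.
have mixed x y z u b b' d : is_wire x -> n x = h y -> edge_dir x z b d ->
    edge_dir y u b' d -> False.
  move=> wire_x E ex ey; have [b0 [Ex Ey]] := gluing_meet glueH E.
  have wire_L : is_wire (@ri A SR b0).
    rewrite (hom_wire _ (proj1 (ri_mono SR))).
    by rewrite -(hom_wire _ (proj1 (rj_mono SR))) -Ex.
  have : ~~ is_end d (@ri A SR b0).
    rewrite rule_is_end -Ex /is_end wire_x /=.
    by apply/negP=> /deg_eq0P /(_ z b); rewrite ex.
  rewrite /is_end wire_L /= => /negP; apply; apply/deg_eq0P=> w c.
  apply/negP=> eL; have := hom_edge_dir hom_m eL.
  rewrite (gluing_comm glueG) -Ey => eG.
  (* Functionality of [G] identifies the edge coming from [L] with the one coming from [K], which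
     [disj] forbids. *)
  have [|] := wG (g y) d (m w) c (g u) b' _ eG (hom_edge_dir hom_g ey).
    by rewrite Ey -(gluing_comm glueG) hom_wire.
  move=> Ew Ec; case: d eL {eG} ey {ex} => /= eL ey.
    by apply: (disj eL ey); rewrite /emap /= (gluing_comm glueG) Ew Ec Ey.
  by apply: (disj eL ey); rewrite /emap /= (gluing_comm glueG) Ew Ec Ey.
move=> v d w b w' b' wire_v.
case/(gluing_edge_dir glueH) => -[x [y [Ev -> e]]];
  case/(gluing_edge_dir glueH) => -[x' [y' [Ev' -> e']]].
- move: Ev' e'; rewrite Ev => /inj_n <- e'.
  have [|-> ->] // := wR x d y b y' b' _ e e'.
  by rewrite -(hom_wire _ hom_n) -Ev.
- have [] := mixed x x' y y' b b' d; rewrite -?Ev //.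
  by rewrite -(hom_wire _ hom_n) -Ev.
- have [] := mixed x' x y' y b' b d; rewrite -?Ev' //.
  by rewrite -(hom_wire _ hom_n) -Ev'.
- move: Ev' e'; rewrite Ev => /inj_h <- e'.
  have [|-> ->] // := wK x d y b y' b' _ e e'.
  by rewrite -(hom_wire _ hom_h) -Ev.
Qed.

Lemma string_graph_replace : string_graph G -> string_graph H.
Proof.
move=> /string_graphP [t w x e]; apply/string_graphP; split.
- exact: all_terminal_replace.
- exact: wire_functional_replace.
- exact: enc_exact_replace.
- exact: no_encoding_replace.
Qed.

Lemma card_is_end_replace d : #|@is_end A G d| = #|@is_end A H d|.
Proof.
rewrite (card_is_end_gluing glueG); last exact: rule_L_end.
rewrite (card_is_end_gluing glueH); last exact: rule_R_end.
apply: eq_card => y; rewrite !inE; congr (_ && _).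
by apply: eq_forallb => b; rewrite rule_is_end.
Qed.

End Replacement.

Lemma pushout_complement_disjoint (SR : sg_rule A) (K G : graph A) C
    (k : rI SR -> K) (m : rL SR -> G) (g : K -> G) :
  is_pushout_complement C (@ri A SR) k m g ->
  forall e e', e \in edges (rL SR) -> e' \in edges K -> emap m e <> emap g e'.
Proof.
case=> _ h e e' eL eK E; have [e0] := h _ _ eL eK E.
by rewrite rI_discrete inE.
Qed.

(** An edge that leaves the image of [L] comes from [K], so its end inside the image is shared by
    [L] and [K]. It lies on the interface, which is the boundary of [L]. *)
Lemma gluing_matching (SR : sg_rule A) (K H G : graph A)
    (k : rI SR -> K) (m : rL SR -> G) (g : K -> G) :
  string_graph H -> wire_homeo H G -> is_gluing (@ri A SR) k m g ->
  matching H m.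
Proof.
move=> sH HG glue; split=> //; first exact: gluing_l glue.
move=> e /(gluing_edges glue) [] [e' _ ->] /=; first by rewrite !codom_f.
have bd y : g y \in codom m -> exists2 b : rL SR, is_boundary b & m b = g y.
  case/codomP=> x /esym E; have [b [Ex _]] := gluing_meet glue E.
  by exists x => //; apply/ri_boundary; exists b.
have [/bd [b bb E] _|_] := boolP (_ \in _); first by exists b => //; left.
by case: (boolP (_ \in _)) => // /bd [b bb E] _; exists b => //; right.
Qed.

End Gluing.

(** * Plugging a graph into a context *)

Section Filling.

Variables (A : alphabets) (J : finType).

(** Demanding a name keeps two unnamed vertices from being matched through [None]. *)
Definition attach (i j : option J) : bool := isSome j && (i == j).

Section Fill.

Variables (Cx : graph A) (eta : Cx -> option J) (N : graph A)
  (nm : N -> option J).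

Definition fill_vert : finType := (Cx + {x : N | ~~ isSome (nm x)})%type.

Definition fill_edge (x : fill_vert) (c : Gamma A) (y : fill_vert) : bool :=
  match x, y with
  | inl o, inl o' => (o, c, o') \in edges Cx
  | inr x, inr x' => (val x, c, val x') \in edges N
  | inl o, inr x =>
      [exists y, attach (eta o) (nm y) && ((y, c, val x) \in edges N)]
  | inr x, inl o =>
      [exists y, attach (eta o) (nm y) && ((val x, c, y) \in edges N)]
  end.

Definition fill_lab (x : fill_vert) : Sigma A :=
  match x with inl o => lab o | inr x => lab (val x) end.

Lemma fill_irrefl x c y :
  (x, c, y) \in [set e : fill_vert * Gamma A * fill_vert
                 | fill_edge e.1.1 e.1.2 e.2] -> x != y.
Proof.
rewrite inE /=; case: x y => [x|x] [y|y] //= he.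
  exact: edges_irrefl he.
exact: edges_irrefl he.
Qed.

(* The context Cx with the unnamed vertices of N plugged in; the edges between
   them are those of N, a context vertex o acting as the vertex of N that
   carries the name eta o. *)
Definition fill : graph A := Graph fill_lab fill_irrefl.

Lemma fill_edgeE (x y : fill) c : ((x, c, y) \in edges fill) = fill_edge x c y.
Proof. by rewrite inE. Qed.

Definition fill_in (U : Type) (f : U -> N) (f_un : forall u, ~~ isSome (nm (f u)))
  (u : U) : fill := inr (exist _ (f u) (f_un u)).

Lemma fill_inE (x : {x : N | ~~ isSome (nm x)}) y : val x = y ->
  forall p, inr x = inr (exist _ y p) :> fill.
Proof. by move=> E p; congr inr; apply: val_inj. Qed.

End Fill.

Section FillMap.

Variables (Cx : graph A) (eta : Cx -> option J).
Variables (N M : graph A) (nmN : N -> option J) (nmM : M -> option J).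
Variable f : N -> M.
Hypothesis nm_f : forall x, nmM (f x) = nmN x.

Lemma fill_map_proof (x : {x : N | ~~ isSome (nmN x)}) :
  ~~ isSome (nmM (f (val x))).
Proof. by rewrite nm_f; exact: (valP x). Qed.

Definition fill_map (x : fill eta nmN) : fill eta nmM :=
  match x with
  | inl o => inl o
  | inr x => inr (exist _ (f (val x)) (fill_map_proof x))
  end.

Lemma fill_map_inj : injective f -> injective fill_map.
Proof.
move=> inj_f [x|x] [y|y] //= [] //; first by move=> ->.
by move/inj_f/val_inj => ->.
Qed.

Lemma fill_map_hom : is_hom f -> is_hom fill_map.
Proof.
move=> hom_f; split=> [[x|x]|[[x c] y]] //=; first by case: hom_f => ->.
rewrite /emap /= !fill_edgeE; case: x y => [x|x] [y|y] //=.
- case/existsP=> z /andP [az ez]; apply/existsP; exists (f z).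
  by rewrite nm_f az (hom_edge hom_f).
- case/existsP=> z /andP [az ez]; apply/existsP; exists (f z).
  by rewrite nm_f az (hom_edge hom_f).
exact: hom_edge.
Qed.

Lemma fill_map_iso : is_iso f -> is_iso fill_map.
Proof.
move=> f_iso; have [g [_ fK gK]] := is_iso_inv f_iso.
apply: is_isoI.
- by apply: fill_map_inj; apply: is_iso_inj.
- case=> [o|y]; first by exists (inl o).
  have un : ~~ isSome (nmN (g (val y))).
    by rewrite -nm_f gK; exact: (valP y).
  exists (inr (exist _ (g (val y)) un)); apply/esym/fill_inE.
  by rewrite gK.
- by case=> [o|x] //=; case: f_iso.
- move=> [x|x] c [y|y]; rewrite !fill_edgeE //=; last exact: is_iso_edge.
    apply/existsP/existsP=> -[z /andP [az ez]].
      exists (g z); rewrite -nm_f gK az -(is_iso_edge _ _ _ f_iso).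
      by rewrite gK.
    by exists (f z); rewrite nm_f az is_iso_edge.
  apply/existsP/existsP=> -[z /andP [az ez]].
    exists (g z); rewrite -nm_f gK az -(is_iso_edge _ _ _ f_iso).
    by rewrite gK.
  by exists (f z); rewrite nm_f az is_iso_edge.
Qed.

End FillMap.

(** Being unnamed, [w] is not the vertex of [N] represented by a context vertex, so the split
    reroutes only edges whose source is the plug vertex [w]. *)
Lemma fill_split (Cx : graph A) (eta : Cx -> option J) (N : graph A)
    (nm : N -> option J) (w : N) (c : Gamma A) (un : ~~ isSome (nm w)) :
  iso (split_graph (inr (exist _ w un) : fill eta nm) c)
      (fill (N := split_graph w c) eta
        (fun x => if x is Some v then nm v else None)).
Proof.
set w' : fill eta nm := inr _.
set nm' := fun x : split_graph w c => _.
pose f (x : split_graph w' c) : fill eta nm' :=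
  match x with
  | Some (inl o) => inl o
  | Some (inr x) =>
      inr (exist (fun y => ~~ isSome (nm' y)) (Some (val x)) (valP x))
  | None => inr (exist (fun y => ~~ isSome (nm' y)) None isT)
  end.
have att o z d x : attach o (nm z) ->
    ((Some z, d, Some x) \in edges (split_graph w c)) = ((z, d, x) \in edges N).
  move=> /andP [nz _]; rewrite split_edgeE andb_idl // => _.
  by apply: contraNneq (un) => <-.
have att0 o z d : attach o (nm z) ->
    ((Some z, d, None) \in edges (split_graph w c)) = false.
  move=> /andP [nz _]; rewrite split_edgeE; case: eqP => //= E.
  by move: (un); rewrite -E nz.
have neq_w x : (inr x != w') = (val x != w).
  by congr negb; apply/eqP/eqP=> [[->] //|E]; apply: fill_inE.
exists f; apply: is_isoI.
- move=> [[o|x]|] [[o'|x']|] //= []; first by move=> ->.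
  by move=> E; congr (Some (inr _)); apply: val_inj.
- case=> [o|[[x|] p]]; first by exists (Some (inl o)).
    by exists (Some (inr (exist _ x p))); apply/esym/fill_inE.
  by exists None; apply/esym/fill_inE.
- by case=> [[o|x]|].
move=> [[o|x]|] d [[o'|x']|]; rewrite split_edgeE fill_edgeE //=.
- by rewrite fill_edgeE.
- rewrite fill_edgeE /=; apply/existsP/existsP=> -[z /andP [az ez]].
    by case: z az ez => [z|] // az; rewrite (att _ _ _ _ az) => ez; exists z;
      rewrite az.
  by exists (Some z); rewrite /= az (att _ _ _ _ az).
- apply/existsP=> -[z /andP [az ez]].
  by case: z az ez => [z|] // az; rewrite (att0 (eta o)).
- rewrite fill_edgeE /= neq_w; apply/existsP/andP=> [[z /andP [az ez]]|].
    case: z az ez => [z|] // az; rewrite split_edgeE => /andP [-> ez].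
    by split=> //; apply/existsP; exists z; rewrite az.
  by case=> xw /existsP [z /andP [az ez]]; exists (Some z);
    rewrite /= az split_edgeE xw.
- by rewrite fill_edgeE neq_w split_edgeE.
- by rewrite split_edgeE -[_ == w']negbK neq_w negbK.
- rewrite fill_edgeE /=; apply/existsP/existsP=> -[z /andP [az ez]].
    by case: z az ez => [z|] // az; rewrite split_edgeE => ez; exists z; rewrite az.
  by exists (Some z); rewrite /= az split_edgeE.
- by rewrite fill_edgeE split_edgeE.
- by rewrite split_edgeE.
Qed.

(** A marked homeomorphism splits only unnamed vertices, and these are vertices of the filled graph
    too. Each of its steps can thus be replayed in any context. *)
Lemma fill_homeo (Cx : graph A) (eta : Cx -> option J) (N M : marked A J) :
  marked_homeo N M -> wire_homeo (fill eta (@name A J N)) (fill eta (@name A J M)).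
Proof.
have iso_step (N' M' : marked A J) : marked_iso N' M' ->
    iso (fill eta (@name A J N')) (fill eta (@name A J M')).
  by case=> f [f_iso nm_f _]; exists (fill_map nm_f); apply: fill_map_iso.
elim=> {N M}.
- move=> N M [/iso_step NM|[w [c [un_w wire_w enc_c /iso_step NM]]]].
    by apply: rst_step; left.
  apply: rst_step; right; exists (inr (exist _ w un_w)), c; split=> //.
  exact: iso_trans (fill_split _ _ _) NM.
- by move=> N; apply: rst_refl.
- by move=> N M _; apply: rst_sym.
- by move=> N M P _ NM _; apply: rst_trans.
Qed.

Section FillGluing.

Variables (Cx : graph A) (eta : Cx -> option J).
Variables (I L K G : graph A).
Variables (i : I -> L) (k : I -> K) (m : L -> G) (g : K -> G).
Variables (nmK : K -> option J) (nmG : G -> option J).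
Hypothesis k_un : forall b, ~~ isSome (nmK (k b)).
Hypothesis m_un : forall x, ~~ isSome (nmG (m x)).
Hypothesis nm_g : forall y, nmG (g y) = nmK y.

(** The image of [L] is unnamed, hence inside the plug, and edges at named vertices can come only
    from [K]. Adding a context merely enlarges [K] and [G] by the same part. *)
Lemma fill_gluing : is_gluing i k m g ->
  is_gluing i (fill_in eta k_un) (fill_in eta m_un) (fill_map (eta := eta) nm_g).
Proof.
case=> [[hom_m inj_m] [hom_g inj_g] comm cover meet edge].
have attG z o : attach o (nmG z) -> forall x, z <> m x.
  by move=> /andP [nz _] x E; move: (m_un x); rewrite -E nz.
have split_att z o c x : attach o (nmG z) -> (z, c, x) \in edges G ->
    exists z' x', [/\ z = g z', x = g x' & (z', c, x') \in edges K].
  move=> /attG nz /edge [] [[[z' c'] x'] e [Ez -> ->]]; first by case: (nz z').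
  by exists z', x'.
have split_att' z o c x : attach o (nmG z) -> (x, c, z) \in edges G ->
    exists z' x', [/\ z = g z', x = g x' & (x', c, z') \in edges K].
  move=> /attG nz /edge [] [[[x' c'] z'] e [-> -> Ez]]; first by case: (nz z').
  by exists z', x'.
split.
- split; last by move=> x y [/inj_m].
  split=> [v|[[x c] y] e] /=; first by case: hom_m.
  by rewrite fill_edgeE; apply: hom_edge.
- by split; [apply: fill_map_hom|apply: fill_map_inj].
- by move=> b; apply: fill_inE; apply: comm.
- case=> [o|v]; first by right; exists (inl o).
  have [[x E]|[y E]] := cover (val v).
    by left; exists x; apply: fill_inE.
  have un : ~~ isSome (nmK y) by rewrite -nm_g -E; exact: (valP v).
  by right; exists (inr (exist _ y un)); apply: fill_inE.
- move=> x [o|y] //= [/meet [b [-> E]]].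
  by exists b; split=> //; apply: fill_inE.
have unK (z : {x : G | ~~ isSome (nmG x)}) y : val z = g y -> ~~ isSome (nmK y).
  by move=> E; rewrite -nm_g -E; apply: (valP z).
case=> [[[o|x] c] [o'|x']]; rewrite fill_edgeE /=.
- by right; exists (inl o, c, inl o') => //; rewrite fill_edgeE.
- case/existsP=> z /andP [az /(split_att _ _ _ _ az) [z' [y [Ez Ey e]]]].
  right; exists (inl o, c, inr (exist _ y (unK _ _ Ey))).
    rewrite fill_edgeE /=; apply/existsP; exists z'.
    by rewrite -nm_g -Ez az.
  by congr (_, _); apply: fill_inE.
- case/existsP=> z /andP [az /(split_att' _ _ _ _ az) [z' [y [Ez Ey e]]]].
  right; exists (inr (exist _ y (unK _ _ Ey)), c, inl o').
    rewrite fill_edgeE /=; apply/existsP; exists z'.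
    by rewrite -nm_g -Ez az.
  by congr (_, _, _); apply: fill_inE.
- case/edge=> -[[[y d] y'] e [Ey -> Ey']].
    left; exists (y, d, y') => //.
    by congr (_, _, _); apply: fill_inE.
  right; exists (inr (exist _ y (unK _ _ Ey)), d, inr (exist _ y' (unK _ _ Ey'))).
    by rewrite fill_edgeE.
  by congr (_, _, _); apply: fill_inE.
Qed.

End FillGluing.

Section FillSelf.

Variables (Cx : graph A) (eta : Cx -> option J) (N : graph A)
  (nm : N -> option J).
Hypothesis eta_inj : injective eta.
Hypothesis nm_inj : forall x y, isSome (nm x) -> nm x = nm y -> x = y.
Hypothesis eta_named : forall o, exists2 x, isSome (nm x) & nm x = eta o.
Hypothesis named_eta : forall x, isSome (nm x) -> exists o, nm x = eta o.
Hypothesis nm_lab : forall x o, isSome (nm x) -> nm x = eta o -> lab x = lab o.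
Hypothesis nm_edge : forall x y o o' c, isSome (nm x) -> isSome (nm y) ->
  nm x = eta o -> nm y = eta o' ->
  ((x, c, y) \in edges N) = ((o, c, o') \in edges Cx).

(** Decomposition of a graph into context and plug: if the named part of [N] is a copy of [Cx], then
    plugging the unnamed part back in recovers [N]. *)
Lemma fill_self : exists f : fill eta nm -> N,
  [/\ is_iso f, forall o, isSome (nm (f (inl o))) /\ nm (f (inl o)) = eta o &
      forall x, f (inr x) = val x].
Proof.
have /fin_all_exists [s sP] o : exists x, isSome (nm x) /\ nm x = eta o.
  by have [x ? ?] := eta_named o; exists x.
pose f (x : fill eta nm) : N := match x with inl o => s o | inr x => val x end.
have attE o z : attach (eta o) (nm z) = (z == s o).
  have [nso Eso] := sP o; rewrite /attach -Eso.
  apply/andP/eqP=> [[nz /eqP E]|->]; last by rewrite nso.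
  exact/esym/nm_inj.
have some_val (x : {x | ~~ isSome (nm x)}) o : val x <> s o.
  by move=> E; have := valP x; rewrite E; case: (sP o) => ->.
exists f; split=> //; apply: is_isoI.
- move=> [o|x] [o'|y] //= E.
  + by congr inl; apply: eta_inj; have [_ <-] := sP o; have [_ <-] := sP o';
      rewrite E.
  + by case: (some_val y o).
  + by case: (some_val x o').
  + by congr inr; apply: val_inj.
- move=> x; have [nx|nx] := boolP (isSome (nm x)).
    have [o Eo] := named_eta nx; exists (inl o) => /=.
    by apply/esym/nm_inj => //; have [_ ->] := sP o.
  by exists (inr (exist _ x nx)).
- by case=> [o|x] //=; have [? ?] := sP o; apply: nm_lab.
move=> [o|x] c [o'|y]; rewrite fill_edgeE //=.
- by have [? ?] := sP o; have [? ?] := sP o'; apply: nm_edge.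
- apply/idP/existsP=> [e|[z]]; first by exists (s o); rewrite attE eqxx.
  by rewrite attE => /andP [/eqP ->].
- apply/idP/existsP=> [e|[z]]; first by exists (s o'); rewrite attE eqxx.
  by rewrite attE => /andP [/eqP ->].
Qed.

End FillSelf.

End Filling.

(** * Decoding *)

Section Decoding.

Variable A : alphabets.
Implicit Types F G H R : graph A.

Lemma string_node_edge R (x : R) c (y : R) : string_graph R -> is_node x -> is_node y ->
  ((x, c, y) \in edges R) = false.
Proof.
move=> /string_graphP [_ _ ex ne] nx ny; apply/negP=> e.
by have := ne _ e; rewrite (ex _ _ _ e) nx ny.
Qed.

Section DecAt.

Variables (H : graph A) (a : H) (al : Gamma A) (b : H).
Variables (R : graph A) (p q : R).

Definition dec_vert : finType := (H + {y : R | (y != p) && (y != q)})%type.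

Definition dec_edge (x : dec_vert) (c : Gamma A) (y : dec_vert) : bool :=
  match x, y with
  | inl x, inl y => ((x, c, y) \in edges H) && ((x, c, y) != (a, al, b))
  | inr x, inr y => (val x, c, val y) \in edges R
  | inl x, inr y => (x == a) && ((p, c, val y) \in edges R)
      || (x == b) && ((q, c, val y) \in edges R)
  | inr y, inl x => (x == a) && ((val y, c, p) \in edges R)
      || (x == b) && ((val y, c, q) \in edges R)
  end.

Definition dec_lab (x : dec_vert) : Sigma A :=
  match x with inl x => lab x | inr y => lab (val y) end.

Lemma dec_irrefl x c y :
  (x, c, y) \in [set e : dec_vert * Gamma A * dec_vert
                 | dec_edge e.1.1 e.1.2 e.2] -> x != y.
Proof.
rewrite inE /=; case: x y => [x|x] [y|y] //= => [/andP [he _]|he].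
  exact: edges_irrefl he.
exact: edges_irrefl he.
Qed.

(* The edge (a, al, b) is replaced by R, with p and q identified with a and b. *)
Definition dec_at : graph A := Graph dec_lab dec_irrefl.

Lemma dec_edgeE (x y : dec_at) c : ((x, c, y) \in edges dec_at) = dec_edge x c y.
Proof. by rewrite inE. Qed.

End DecAt.

Lemma dec_at_iso H G (f : H -> G) a al b R (p q : R) : is_iso f ->
  iso (dec_at a al b p q) (dec_at (f a) al (f b) p q).
Proof.
move=> f_iso; have inj_f := is_iso_inj f_iso.
have [g [_ fK gK]] := is_iso_inv f_iso.
pose F (x : dec_at a al b p q) : dec_at (f a) al (f b) p q :=
  match x with inl x => inl (f x) | inr y => inr y end.
exists F; apply: is_isoI.
- by move=> [x|x] [y|y] // [] => [/inj_f|] ->.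
- by case=> [x|y]; [exists (inl (g x)); rewrite /= gK|exists (inr y)].
- by case=> [x|y] //=; case: f_iso.
move=> [x|x] c [y|y]; rewrite !dec_edgeE //= ?(inj_eq inj_f) //.
rewrite is_iso_edge //; congr (_ && ~~ _).
by rewrite !xpair_eqE !(inj_eq inj_f).
Qed.

Lemma dec_at_comm H (a1 b1 a2 b2 : H) al1 al2 (R1 R2 : graph A) (p1 q1 : R1) (p2 q2 : R2) :
  iso (@dec_at (dec_at a1 al1 b1 p1 q1) (inl a2) al2 (inl b2) R2 p2 q2)
      (@dec_at (dec_at a2 al2 b2 p2 q2) (inl a1) al1 (inl b1) R1 p1 q1).
Proof.
set G1 := dec_at _ _ _ _ _; set G2 := dec_at _ _ _ _ _.
pose F (x : G1) : G2 :=
  match x with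
  | inl (inl x) => inl (inl x)
  | inl (inr y) => inr y
  | inr z => inl (inr z)
  end.
exists F; apply: is_isoI.
- by move=> [[x|x]|x] [[y|y]|y] // [] ->.
- case=> [[x|x]|x]; [by exists (inl (inl x))|by exists (inr x)|].
  by exists (inl (inr x)).
- by case=> [[x|x]|x].
have llE (U V : eqType) (x y : U) : (inl x == inl y :> U + V) = (x == y) by [].
have rlE (U V : eqType) (x : U) (y : V) : (inr y == inl x) = false by [].
move=> [[x|x]|x] c [[y|y]|y]; rewrite !dec_edgeE //= ?dec_edgeE /= ?xpair_eqE
  ?llE ?rlE ?andbF ?andbT //.
by rewrite andbAC.
Qed.

Variable T : decoding_system A.

(** The result of a decoding step made explicit up to isomorphism, so that confluence can be checked
    without pushouts. *)
Definition dstep H H' : Prop :=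
  exists (a : H) al (b : H) n1 n2,
    [/\ (a, al, b) \in edges H, [/\ al \in Enc A, n1 \in NodeL A & n2 \in NodeL A],
        lab a = n1, lab b = n2 &
        iso (dec_at a al b (@dec_emb A T al n1 n2 false)
               (@dec_emb A T al n1 n2 true)) H'].

Lemma dstep_isol H G H' : iso H G -> dstep H H' -> dstep G H'.
Proof.
case=> f f_iso [a [al [b [n1 [n2 [e enc la lb HH']]]]]].
exists (f a), al, (f b), n1, n2; split=> //.
- by rewrite is_iso_edge.
- by case: f_iso => _ ->.
- by case: f_iso => _ ->.
exact: iso_trans (iso_sym (dec_at_iso _ _ _ _ _ f_iso)) HH'.
Qed.

(** Decoding one edge leaves every other encoding edge in place with the same end labels. For equal
    edges, the labels of the ends force the same rule. *)
Lemma dstep_diamond H H1 H2 : dstep H H1 -> dstep H H2 ->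
  iso H1 H2 \/ exists G, dstep H1 G /\ dstep H2 G.
Proof.
case=> a1 [al1 [b1 [n1 [n1' [e1 enc1 la1 lb1 iso1]]]]].
case=> a2 [al2 [b2 [n2 [n2' [e2 enc2 la2 lb2 iso2]]]]].
have [E|neq] := eqVneq (a1, al1, b1) (a2, al2, b2).
  left; case: E => Ea Eal Eb; subst.
  exact: iso_trans (iso_sym iso1) iso2.
right; set d1 := dec_at _ _ _ _ _ in iso1; set d2 := dec_at _ _ _ _ _ in iso2.
exists (@dec_at d1 (inl a2) al2 (inl b2) _
  (@dec_emb A T al2 n2 n2' false) (@dec_emb A T al2 n2 n2' true)); split.
  apply: dstep_isol iso1 _; exists (inl a2), al2, (inl b2), n2, n2'; split=> //.
    by rewrite dec_edgeE /= e2 eq_sym.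
  exact: iso_refl.
apply: dstep_isol iso2 _; exists (inl a1), al1, (inl b1), n1, n1'; split=> //.
  by rewrite dec_edgeE /= e1.
exact: dec_at_comm.
Qed.

(** The interface contains both ends of the decoded edge, so the complement [K] has all the vertices
    of [H] and lacks just that edge. The second gluing then adds the interior of the right-hand
    side. *)
Lemma decode_step_dstep H H' : decode_step T H H' -> dstep H H'.
Proof.
case=> al [n1 [n2 [enc_al node1 node2 [K [m [g [h [mono_m]]]]]]]].
case=> k [n [[po1 disj] po2]].
have [mono_emb string_R _ _] := dec_ok T enc_al node1 node2.
set R := dec_rhs T al n1 n2 in n po2 mono_emb string_R *.
set emb := @dec_emb A T al n1 n2 in mono_emb po2 *.
have comm1 x : m x = g (k x) by case: po1 => _ _ /(_ x).
have inj_k : injective k.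
  by move=> x y E; case: mono_m => _; apply; rewrite !comm1 E.
have glue1 : is_gluing (@pair_to_edge A al n1 n2) k m g.
  by apply: pushout_gluing po1.
have glue2 : is_gluing emb k n h.
  by apply: pushout_gluing po2 => //; case: mono_emb.
have [hom_m inj_m] := mono_m; have [hom_g inj_g] := gluing_r glue1.
have [hom_n inj_n] := gluing_l glue2; have [hom_h inj_h] := gluing_r glue2.
have surj_g v : exists y, g y = v.
  have [[x ->]|[y ->]] := gluing_cover glue1 v; last by exists y.
  by exists (k x); rewrite comm1.
have [gi giK gK] := inj_surj_bij inj_g surj_g.
have node_emb x : is_node (emb x).
  by rewrite (hom_node _ (proj1 mono_emb)) /is_node; case: x.
have comm2 x : n (emb x) = h (k x) by apply: (gluing_comm glue2).
have gi_m x : gi (m x) = k x by rewrite comm1 giK.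
exists (m false), al, (m true), n1, n2; split=> //.
- by apply: (hom_edge hom_m); rewrite inE.
- by case: hom_m => ->.
- by case: hom_m => ->.
pose f (x : dec_at (m false) al (m true) (emb false) (emb true)) : H' :=
  match x with inl x => h (gi x) | inr y => n (val y) end.
have meetF (y : {y : R | (y != emb false) && (y != emb true)}) z : n (val y) <> h z.
  move/(gluing_meet glue2) => [x [E _]]; have := valP y; rewrite E.
  by case: x E => _; rewrite eqxx ?andbF.
have edge_K x c y : (x, c, y) \in edges H -> (x, c, y) != (m false, al, m true) ->
    (gi x, c, gi y) \in edges K.
  move=> /(gluing_edges glue1) [] [[[x' c'] y'] e [-> -> ->]].
    by move: e; rewrite inE => /eqP [-> -> ->]; rewrite eqxx.
  by rewrite !giK.
exists f; apply: is_isoI.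
- move=> [x|x] [y|y] //=.
  + by move/inj_h/(can_inj gK) ->.
  + by move/esym/meetF.
  + by move/meetF.
  + by move/inj_n/val_inj ->.
- move=> v; have [[x ->]|[y ->]] := gluing_cover glue2 v; last first.
    by exists (inl (g y)); rewrite /= giK.
  have [->|x0] := eqVneq x (emb false).
    by exists (inl (m false)); rewrite /= gi_m comm2.
  have [->|x1] := eqVneq x (emb true).
    by exists (inl (m true)); rewrite /= gi_m comm2.
  have x01 : (x != emb false) && (x != emb true) by rewrite x0.
  by exists (inr (exist _ x x01)).
- case=> [x|y] /=; last by case: hom_n.
  by case: hom_h => -> _; rewrite -[in RHS](gK x); case: hom_g => ->.
have hn x z : h z = n x -> exists2 b, x = emb b & g z = m b.
  move/esym/(gluing_meet glue2) => [b [-> ->]]; exists b => //.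
(* The two interface vertices are node-vertices of a string graph, so no new edge joins two old
   vertices. *)
have no_emb s t c : (emb s, c, emb t) \in edges R -> False.
  by rewrite string_node_edge.
move=> [x|x] c [y|y]; rewrite dec_edgeE /=.
- apply/idP/andP=> [|[e neq]]; last by apply: (hom_edge hom_h); apply: edge_K.
  case/(gluing_edges glue2) => -[[[x' c'] y'] e [Ex -> Ey]].
    have [s Es _] := hn _ _ Ex; have [t Et _] := hn _ _ Ey.
    by rewrite Es Et in e; case: (no_emb _ _ _ e).
  move/inj_h: Ex => Ex; move/inj_h: Ey => Ey.
  rewrite -{1}[x]gK -{1}[y]gK Ex Ey (hom_edge hom_g) //; split=> //.
  apply/eqP=> -[Em Ec Em'].
  have eL : (false, al, true) \in edges (edge_graph al n1 n2) by rewrite inE.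
  have [|e0] := disj _ _ eL e; last by rewrite inE.
  by rewrite /emap /= -Ec -Em -Em' -Ex -Ey !gK.
- apply/idP/orP.
    case/(gluing_edges glue2) => -[[[x' c'] y'] e [Ex -> Ey]];
      last by case: (meetF y y').
    move/inj_n: Ey => Ey; have [s Es] := hn _ _ Ex; rewrite gK => Em; subst.
    by case: s e {Ex} => e; [right|left]; rewrite eqxx.
  by case=> /andP [/eqP ->]; rewrite gi_m -comm2; apply: hom_edge.
- apply/idP/orP.
    case/(gluing_edges glue2) => -[[[x' c'] y'] e [Ex -> Ey]];
      last by case: (meetF x x').
    move/inj_n: Ex => Ex; have [s Es] := hn _ _ Ey; rewrite gK => Em; subst.
    by case: s e {Ey} => e; [right|left]; rewrite eqxx.
  by case=> /andP [/eqP ->]; rewrite gi_m -comm2; apply: hom_edge.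
apply/idP/idP; last exact: hom_edge.
case/(gluing_edges glue2) => -[[[x' c'] y'] e [Ex -> Ey]];
  last by case: (meetF x x').
by move/inj_n: Ex => ->; move/inj_n: Ey => ->.
Qed.

(** * Uniqueness of complete decodings *)

Fixpoint dsteps n H F : Prop :=
  if n is n'.+1 then exists H', dstep H H' /\ dsteps n' H' F else iso H F.

Lemma dsteps_isol n H G F : iso H G -> dsteps n H F -> dsteps n G F.
Proof.
case: n => [|n] HG /=; first by move=> HF; apply: iso_trans HF; apply: iso_sym.
by case=> H' [HH' H'F]; exists H'; split=> //; apply: dstep_isol HG HH'.
Qed.

Lemma dsteps_trans n k H G F : dsteps n H G -> dsteps k G F -> dsteps (n + k) H F.
Proof.
elim: n H => [|n IHn] H /=; first by move/iso_sym; apply: dsteps_isol.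
by case=> H' [HH' H'G] GF; exists H'; split=> //; apply: IHn.
Qed.

Lemma decodes_dsteps H F : decodes T H F -> exists n, dsteps n H F.
Proof.
case=> HF _; elim: HF => {H F}.
- move=> H F [HF|/decode_step_dstep HF]; first by exists 0.
  by exists 1, F; split=> //; apply: iso_refl.
- by move=> H; exists 0; apply: iso_refl.
- by move=> H G F _ [n HG] _ [k GF]; exists (n + k); apply: dsteps_trans GF.
Qed.

Lemma no_encoding_dstep H H' : no_encoding H -> ~ dstep H H'.
Proof.
move=> ne [a [al [b [n1 [n2 [e [enc _ _] _ _ _]]]]]].
by have := ne _ e; rewrite enc.
Qed.

(** The diamond closes with exactly one step on each side, so any available step can be moved to the
    front of a complete decoding at unchanged length. The induction is on that length. *)
Lemma dsteps_exchange n H H' F : no_encoding F -> dsteps n H F -> dstep H H' ->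
  exists2 n', n = n'.+1 & dsteps n' H' F.
Proof.
move=> neF; elim: n H H' => [|n IHn] H H' /= HF HH'.
  by case: (no_encoding_dstep (no_encoding_iso HF neF) HH').
case: HF => H1 [HH1 H1F]; exists n => //.
have [H1H'|[G [H1G H'G]]] := dstep_diamond HH1 HH'; first exact: dsteps_isol H1F.
by have [n' -> GF] := IHn _ _ H1F H1G; exists G.
Qed.

Lemma dsteps_unique n k H F F' : no_encoding F -> no_encoding F' ->
  dsteps n H F -> dsteps k H F' -> iso F F'.
Proof.
move=> neF neF'; elim: k n H => [|k IHk] n H /=.
  case: n => [|n] /= HF HF'; first exact: iso_trans (iso_sym HF) HF'.
  have neH : no_encoding H := no_encoding_iso HF' neF'.
  by case: HF => H' [/(no_encoding_dstep neH)].
move=> HF [H' [HH' H'F']]; have [n' _ H'F] := dsteps_exchange neF HF HH'.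
exact: IHk H'F H'F'.
Qed.

Definition encoded_string_graph H : Prop :=
  [/\ all_terminal H, wire_functional H & enc_exact H].

Lemma encoded_string_graph_iso G H :
  iso G H -> encoded_string_graph H -> encoded_string_graph G.
Proof.
move=> gh [t w x]; split.
- exact: all_terminal_iso gh t.
- exact: wire_functional_iso gh w.
exact: enc_exact_iso gh x.
Qed.

Lemma not_node_wire H (x : H) : is_node x -> is_wire x -> False.
Proof.
rewrite /is_node /is_wire => node_x wire_x.
by have := disjointFr (node_wire_disjoint A) node_x; rewrite wire_x.
Qed.

(** The ends of the decoded edge are node-vertices, so no old wire gains or loses an edge; a new
    wire has only the edges it has in the right-hand side. *)
Lemma encoded_string_graph_dstep H H' :
  dstep H H' -> encoded_string_graph H -> encoded_string_graph H'.
Proof.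
case=> a [al [b [n1 [n2 [e [enc node1 node2] la lb iso_H']]]]] [tH wH eH].
have [[hom_emb inj_emb] sR _ _] := dec_ok T enc node1 node2.
have /string_graphP [tR wR eR neR] := sR.
apply: encoded_string_graph_iso (iso_sym iso_H') _.
set p := @dec_emb A T al n1 n2 false in iso_H' *.
set q := @dec_emb A T al n1 n2 true in iso_H' *.
have lp : lab p = lab a by case: hom_emb => -> _.
have lq : lab q = lab b by case: hom_emb => -> _.
have pq : p != q by apply/eqP=> /inj_emb.
have node_a : is_node a by rewrite /is_node la.
have node_b : is_node b by rewrite /is_node lb.
split.
- by case=> [x|y] /=.
- have liftR (y : {y | (y != p) && (y != q)}) w c d :
      @edge_dir A (dec_at a al b p q) (inr y) w c d ->
      exists2 z, edge_dir (val y) z c d &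
        match w with
        | inr w => z = val w
        | inl x => x = a /\ z = p \/ x = b /\ z = q
        end.
    case: d => /=; rewrite dec_edgeE /=; case: w => [x|w].
    + by case/orP=> /andP [/eqP -> ey]; [exists p|exists q] => //; [left|right].
    + by move=> ey; exists (val w).
    + by case/orP=> /andP [/eqP -> ey]; [exists p|exists q] => //; [left|right].
    + by move=> ey; exists (val w).
  have not_p (y : {y | (y != p) && (y != q)}) : p <> val y.
    by move=> E; case/andP: (valP y); rewrite -E eqxx.
  have not_q (y : {y | (y != p) && (y != q)}) : q <> val y.
    by move=> E; case/andP: (valP y); rewrite -E eqxx.
  case=> [v|y] d w c w' c' wire_v e1 e2.
    have va : (v == a) = false.
      by apply/eqP=> E; apply: (not_node_wire node_a); rewrite -E.
    have vb : (v == b) = false.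
      by apply/eqP=> E; apply: (not_node_wire node_b); rewrite -E.
    case: w w' e1 e2 => [w|w] [w'|w'];
      case: d => /=; rewrite !dec_edgeE /= ?va ?vb //= => /andP [e1 _] /andP [e2 _].
      by have [-> ->] := wH v d_in _ _ _ _ wire_v e1 e2.
    by have [-> ->] := wH v d_out _ _ _ _ wire_v e1 e2.
  have [z ez Ew] := liftR _ _ _ _ e1; have [z' ez' Ew'] := liftR _ _ _ _ e2.
  have [Ez <-] := wR (val y) d _ _ _ _ wire_v ez ez'; split=> //.
  subst z'; case: w w' Ew Ew' {e1 e2} => [w|w] [w'|w'] /=.
  + case=> -[-> E1] [] [-> E2] //; move: pq; first by rewrite -E1 -E2 eqxx.
    by rewrite -E1 -E2 eqxx.
  + by case=> -[_ ->]; [move/not_p|move/not_q].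
  + by move=> -> [] [_ /esym]; [move/not_p|move/not_q].
  + by move=> -> /val_inj ->.
- move=> [x|x] c [y|y]; rewrite dec_edgeE /=.
  + by case/andP=> /eH.
  + case/orP=> /andP [/eqP -> /eR ->]; rewrite /is_node /= ?lp ?lq //.
  + case/orP=> /andP [/eqP -> /eR ->]; rewrite /is_node /= ?lp ?lq //.
  + by move/eR.
Qed.

Lemma dsteps_encoded n H F :
  dsteps n H F -> encoded_string_graph H -> encoded_string_graph F.
Proof.
elim: n H => [|n IHn] H /=; first by move/iso_sym; apply: encoded_string_graph_iso.
by case=> H' [HH' H'F] /(encoded_string_graph_dstep HH'); apply: IHn.
Qed.

End Decoding.

(** * Replacing a plug *)

Section Substitutions.

Variable A : alphabets.

Lemma subst_edgeE (H : graph A) (v : H) (D : emb_graph A) (x y : subst_graph v D) c :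
  ((x, c, y) \in edges (subst_graph v D)) = subst_edge x c y.
Proof. by rewrite inE. Qed.

Lemma subst_iso (H G : graph A) (f : H -> G) (v : H) (v0 : G)
    (D E : emb_graph A) (phi : D -> E) :
  is_iso f -> f v = v0 -> is_iso phi ->
  (forall s b c x d, inst s b c (phi x) d = inst s b c x d) ->
  exists F : subst_graph v D -> subst_graph v0 E,
    [/\ is_iso F,
        forall x, exists2 y, F (inl x) = inl y & val y = f (val x) &
        forall a, F (inr a) = inr (phi a)].
Proof.
move=> f_iso Ev phi_iso inst_phi; have inj_f := is_iso_inj f_iso.
have [fi [_ fK fiK]] := is_iso_inv f_iso.
have [psi [_ phiK psiK]] := is_iso_inv phi_iso.
have f_neq (x : {x | x != v}) : f (val x) != v0.
  by rewrite -Ev (inj_eq inj_f) (valP x).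
pose F (x : subst_graph v D) : subst_graph v0 E :=
  match x with
  | inl x => inl (exist _ (f (val x)) (f_neq x))
  | inr a => inr (phi a)
  end.
have lf x : lab (f x) = lab x by case: f_iso.
exists F; split=> //; last by move=> x; exists (exist _ (f (val x)) (f_neq x)).
apply: is_isoI.
- move=> [x|a] [y|b] // []; first by move/inj_f/val_inj ->.
  by move/(is_iso_inj phi_iso) ->.
- case=> [y|b]; last by exists (inr (psi b)); rewrite /= psiK.
  have fi_neq : fi (val y) != v by rewrite -(inj_eq inj_f) fiK Ev (valP y).
  exists (inl (exist _ (fi (val y)) fi_neq)); congr inl; apply: val_inj.
  exact: fiK.
- by case=> [x|a] //=; case: phi_iso.
move=> [x|a] c [y|b]; rewrite !subst_edgeE /= ?is_iso_edge // -Ev.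
  by apply: eq_existsb => d; rewrite is_iso_edge // lf inst_phi.
by apply: eq_existsb => d; rewrite is_iso_edge // lf inst_phi.
Qed.

Variable J : finType.

Definition eta_subst (Cx : graph A) (v : Cx) (E : emb_graph A)
    (eta : Cx -> option J) (x : subst_graph v E) : option J :=
  if x is inl o then eta (val o) else None.

(** Instructions transform edges at the replaced vertex only. As none of these reaches the plug, the
    inserted body is not attached to it, which is why [eta_subst] leaves its vertices unnamed. *)
Lemma fill_subst (Cx N : graph A) (eta : Cx -> option J) (nm : N -> option J)
    (v : Cx) (E : emb_graph A) :
  (forall c x, ((inl v : fill eta nm, c, inr x) \in edges (fill eta nm)) = false) ->
  (forall c x, ((inr x, c, inl v : fill eta nm) \in edges (fill eta nm)) = false) ->
  exists F : fill (eta_subst (v := v) (E := E) eta) nm ->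
      subst_graph (inl v : fill eta nm) E,
    [/\ is_iso F,
        forall o, exists2 y, F (inl (inl o)) = inl y & val y = inl (val o) &
        forall a, F (inl (inr a)) = inr a].
Proof.
move=> out_v in_v.
pose F (x : fill (eta_subst (v := v) (E := E) eta) nm) :
    subst_graph (inl v : fill eta nm) E :=
  match x with
  | inl (inl o) => inl (exist (fun z : fill eta nm => z != inl v)
                              (inl (val o)) (valP o))
  | inl (inr a) => inr a
  | inr x => inl (exist (fun z : fill eta nm => z != inl v) (inr x) isT)
  end.
exists F; split=> //; last first.
  by move=> o; exists (exist (fun z : fill eta nm => z != inl v)
    (inl (val o)) (valP o)).
apply: is_isoI.
- move=> [[x|x]|x] [[y|y]|y] // [].
  + by move/val_inj ->.
  + by move->.
  + by move->.
- case=> [[[o|x] p]|a]; last by exists (inl (inr a)).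
    exists (inl (inl (exist (fun o => o != v) o p))).
    by congr inl; apply: val_inj.
  by exists (inr x); congr inl; apply: val_inj.
- by case=> [[x|x]|x].
move=> [[x|x]|x] c [[y|y]|y]; rewrite subst_edgeE !fill_edgeE //= ?fill_edgeE
  ?subst_edgeE //=.
- by apply: eq_existsb => d; rewrite fill_edgeE.
- by apply: eq_existsb => d; rewrite fill_edgeE.
- apply/existsP/existsP=> -[z]; first by rewrite out_v.
  by case/andP=> /andP [nz /eqP Ez]; rewrite -Ez in nz.
- apply/existsP/existsP=> -[z]; first by rewrite in_v.
  by case/andP=> /andP [nz /eqP Ez]; rewrite -Ez in nz.
Qed.

Definition fill_emb (Cx : emb_graph A) (eta : Cx -> option J) (N : graph A)
    (nm : N -> option J) : emb_graph A :=
  @EmbGraph A (fill eta nm)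
    (fun s b c x d => if x is inl o then inst s b c o d else false).

Definition eta_body (H : graph A) (v : H) (Cx : emb_graph A)
    (eta : Cx -> option J) (x : subst_graph v Cx) : option J :=
  if x is inr o then eta o else None.

(** In [fill_emb] plug vertices have no instructions, so the host graph acquires no edges to the
    plug; accordingly [eta_body] gives host vertices no name. *)
Lemma subst_fill (H : graph A) (v : H) (Cx : emb_graph A)
    (eta : Cx -> option J) (N : graph A) (nm : N -> option J) :
  exists F : fill (eta_body (v := v) eta) nm -> subst_graph v (fill_emb eta nm),
    [/\ is_iso F, forall w, F (inl (inl w)) = inl w &
        forall o, F (inl (inr o)) = inr (inl o)].
Proof.
pose F (x : fill (eta_body (v := v) eta) nm) : subst_graph v (fill_emb eta nm) :=
  match x with
  | inl (inl w) => inl w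
  | inl (inr o) => inr (inl o)
  | inr x => inr (inr x)
  end.
exists F; split=> //; apply: is_isoI.
- by move=> [[x|x]|x] [[y|y]|y] // [] ->.
- case=> [w|[o|x]]; [by exists (inl (inl w))|by exists (inl (inr o))|].
  by exists (inr x).
- by case=> [[x|x]|x].
have noex (P : pred N) (Q : pred (Gamma A)) :
    [exists b, Q b && false] = [exists y : N, attach None (nm y) && P y].
  apply/existsP/existsP=> -[z]; first by rewrite andbF.
  by case/andP=> /andP [nz /eqP Ez]; rewrite -Ez in nz.
move=> [[x|x]|x] c [[y|y]|y]; rewrite subst_edgeE !fill_edgeE //= ?fill_edgeE
  ?subst_edgeE //=.
Qed.

Lemma fill_dec (Cx : graph A) (eta : Cx -> option J) (N : graph A)
    (nm : N -> option J) (a : Cx) al (b : Cx) (R : graph A) (p q : R) :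
  iso (fill (Cx := dec_at a al b p q)
         (fun x => if x is inl o then eta o else None) nm)
      (dec_at (inl a : fill eta nm) al (inl b) p q).
Proof.
set G1 := fill _ _; set G2 := dec_at _ _ _ _ _.
pose F (x : G1) : G2 :=
  match x with
  | inl (inl o) => inl (inl o)
  | inl (inr y) => inr y
  | inr x => inl (inr x)
  end.
exists F; apply: is_isoI.
- by move=> [[x|x]|x] [[y|y]|y] // [] ->.
- case=> [[o|x]|y]; [by exists (inl (inl o))|by exists (inr x)|].
  by exists (inl (inr y)).
- by case=> [[x|x]|x].
have noex (P : pred N) : [exists y : N, attach None (nm y) && P y] = false.
  apply/existsP=> -[z].
  by case/andP=> /andP [nz /eqP Ez]; rewrite -Ez in nz.
have llE (U V : eqType) (x y : U) : (inl x == inl y :> U + V) = (x == y) by [].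
have rlE (U V : eqType) (x : U) (y : V) : (inr y == inl x) = false by [].
move=> [[x|x]|x] c [[y|y]|y]; rewrite !dec_edgeE !fill_edgeE //= ?fill_edgeE
  ?dec_edgeE //= ?noex ?xpair_eqE ?llE ?rlE ?andbF ?andbT //.
Qed.

End Substitutions.

(** * Replacements under derivation, decoding and rewriting *)

Section Replacements.

Variables (A : alphabets) (J : finType) (labJ : J -> Sigma A).

(** What lets the plug commute with the two kinds of step: [plug_term] keeps non-terminals away from
    it, for substitution, and [plug_enc] keeps encoding edges in the context, for decoding. Both use
    [plug_lab] or the attachment by names to pass to a filled graph. *)
Record pluggable (N : graph A) (nm : N -> option J) : Prop := Pluggable {
  plug_lab : forall x j, nm x = Some j -> lab x = labJ j;
  plug_term : forall x c y, ~~ isSome (nm x) ->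
    (x, c, y) \in edges N \/ (y, c, x) \in edges N -> lab y \in terminals A;
  plug_enc : forall x c y, ~~ isSome (nm x) ->
    (x, c, y) \in edges N \/ (y, c, x) \in edges N -> c \notin Enc A }.

Definition eta_ok (Cx : graph A) (eta : Cx -> option J) : Prop :=
  forall o j, eta o = Some j -> lab o = labJ j.

Section FillPlug.

Variables (Cx : graph A) (eta : Cx -> option J).
Variables (N : graph A) (nm : N -> option J).
Hypothesis ok : eta_ok eta.
Hypothesis plug : pluggable nm.

Lemma attach_lab o y : attach (eta o) (nm y) -> lab y = lab o.
Proof.
case: (nm y) (@plug_lab _ _ plug y) => // j lab_y /andP [_ /eqP E].
by rewrite (lab_y j erefl) (ok E).
Qed.

Lemma fill_nonterminal o c x : lab o \notin terminals A ->
  ((inl o : fill eta nm, c, inr x) \in edges (fill eta nm)) = false /\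
  ((inr x, c, inl o : fill eta nm) \in edges (fill eta nm)) = false.
Proof.
move=> nt_o; split; rewrite fill_edgeE /=;
  apply/existsP=> -[y /andP [/attach_lab Ey e]]; case/negP: nt_o; rewrite -Ey;
  apply: (plug_term plug (valP x)); eauto.
Qed.

Lemma fill_enc_edge (x : fill eta nm) c y : c \in Enc A ->
  (x, c, y) \in edges (fill eta nm) -> exists o o', x = inl o /\ y = inl o'.
Proof.
move=> enc_c; rewrite fill_edgeE; case: x y => [o|x] [o'|y] /=;
  first by exists o, o'.
- case/existsP=> z /andP [_ e]; case/negP: (plug_enc plug (valP y) (or_intror e)).
  exact: enc_c.
- case/existsP=> z /andP [_ e]; case/negP: (plug_enc plug (valP x) (or_introl e)).
  exact: enc_c.
by move=> e; case/negP: (plug_enc plug (valP x) (or_introl e)).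
Qed.

End FillPlug.

Variables (D D' : graph A) (nm : D -> option J) (nm' : D' -> option J).
Hypothesis plug : pluggable nm.
Hypothesis plug' : pluggable nm'.

(* H' is H with one copy of the plug D replaced by D'; the tracking T may only
   relate corresponding vertices of the common context. *)
Definition replacement (H H' : graph A) (T : H -> H' -> Prop) : Prop :=
  exists (Cx : graph A) (eta : Cx -> option J) (f : fill eta nm -> H)
      (f' : fill eta nm' -> H'),
    [/\ eta_ok eta, is_iso f, is_iso f' &
        forall x y, T x y -> exists2 o, x = f (inl o) & y = f' (inl o)].

(** Every constructor bounds the tracking only from above, so a tracking may be shrunk at will, in
    particular to the non-terminals. *)
Inductive replacements : forall H H' : graph A, (H -> H' -> Prop) -> Prop :=
| repl_iso (H H' : graph A) (T : H -> H' -> Prop) (f : H -> H') :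
    is_iso f -> (forall x y, T x y -> y = f x) -> replacements T
| repl_step (H H' : graph A) (T : H -> H' -> Prop) :
    replacement T -> replacements T
| repl_trans (H1 H2 H3 : graph A) (T1 : H1 -> H2 -> Prop) (T2 : H2 -> H3 -> Prop)
    (T : H1 -> H3 -> Prop) :
    replacements T1 -> replacements T2 ->
    (forall x z, T x z -> exists2 y, T1 x y & T2 y z) -> replacements T.

(** Needed for substitution in a composite: a vertex other than the replaced one must not be tracked
    through the replaced vertex of the middle graph. *)
Lemma replacements_inj (H H' : graph A) (T : H -> H' -> Prop) :
  replacements T -> forall x x' y, T x y -> T x' y -> x = x'.
Proof.
elim=> {H H' T}.
- move=> H H' T f f_iso Tf x x' y /Tf -> /Tf; exact: is_iso_inj.
- move=> H H' T [Cx [eta [f [f' [_ _ f'_iso TP]]]]] x x' y.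
  by move=> /TP [o -> ->] /TP [o' -> /(is_iso_inj f'_iso) [->]].
- move=> H1 H2 H3 T1 T2 T _ inj1 _ inj2 TP x x' z.
  move=> /TP [y xy yz] /TP [y' xy' /(inj2 _ _ _ yz) E]; subst y'.
  exact: inj1 xy xy'.
Qed.

Lemma replacements_lab (H H' : graph A) (T : H -> H' -> Prop) :
  replacements T -> forall x y, T x y -> lab x = lab y.
Proof.
elim=> {H H' T}.
- by move=> H H' T f [_ lf _] Tf x y /Tf ->.
- move=> H H' T [Cx [eta [f [f' [_ [_ lf _] [_ lf' _] TP]]]]] x y.
  by move=> /TP [o -> ->]; rewrite lf lf'.
- by move=> H1 H2 H3 T1 T2 T _ l1 _ l2 TP x z /TP [y /l1 -> /l2].
Qed.

(** The tracked vertex is a context vertex with non-terminal label, so it has no edge to either plug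
    and [fill_subst] applies on both sides with the same new context. *)
Lemma replacement_subst (H H' : graph A) (T : H -> H' -> Prop) v v' (E : emb_graph A) :
  replacement T -> T v v' -> lab v \notin terminals A ->
  replacement (subst_track (v1 := v) (v2 := v') (D1 := E) (D2 := E) T eq).
Proof.
move=> [Cx [eta [f [f' [ok f_iso f'_iso TP]]]]] Tvv' nt_v.
have [o Ev Ev'] := TP _ _ Tvv'.
have nt_o : lab o \notin terminals A.
  by move: nt_v; rewrite Ev; case: f_iso => _ ->.
have [G [G_iso G1 G2]] := fill_subst E
  (fun c x => proj1 (fill_nonterminal ok plug c x nt_o))
  (fun c x => proj2 (fill_nonterminal ok plug c x nt_o)).
have [G' [G'_iso G'1 G'2]] := fill_subst E
  (fun c x => proj1 (fill_nonterminal ok plug' c x nt_o))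
  (fun c x => proj2 (fill_nonterminal ok plug' c x nt_o)).
have [F [F_iso F1 F2]] := subst_iso f_iso (esym Ev) (is_iso_id E)
  (fun _ _ _ _ _ => erefl).
have [F' [F'_iso F'1 F'2]] := subst_iso f'_iso (esym Ev') (is_iso_id E)
  (fun _ _ _ _ _ => erefl).
exists (subst_graph o E), (eta_subst eta), (F \o G), (F' \o G'); split.
- by case=> [w|a] //= j /ok.
- exact: is_iso_comp.
- exact: is_iso_comp.
case=> [x|a] [y|b] //= => [|->]; last by exists (inr b); rewrite ?G2 ?G'2 ?F2 ?F'2.
move=> /TP [w Ex Ey].
have neq_w : w != o.
  by apply/eqP=> Ew; move: (valP x); rewrite /= Ex Ev Ew eqxx.
exists (inl (exist (fun w => w != o) w neq_w)).
  have [z -> Ez] := G1 (exist _ w neq_w); have [z' -> Ez'] := F1 z.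
  by congr inl; apply: val_inj; rewrite Ez' Ez; exact: Ex.
have [z -> Ez] := G'1 (exist _ w neq_w); have [z' -> Ez'] := F'1 z.
by congr inl; apply: val_inj; rewrite Ez' Ez; exact: Ey.
Qed.

Lemma replacements_subst (H H' : graph A) (T : H -> H' -> Prop) (E : emb_graph A) :
  replacements T -> forall v v', T v v' -> lab v \notin terminals A ->
  replacements (subst_track (v1 := v) (v2 := v') (D1 := E) (D2 := E) T eq).
Proof.
elim=> {H H' T}.
- move=> H H' T f f_iso Tf v v' /Tf Ev' nt_v.
  have [F [F_iso F1 F2]] := subst_iso f_iso (esym Ev') (is_iso_id E)
    (fun _ _ _ _ _ => erefl).
  apply: (repl_iso F_iso) => -[x|a] [y|b] //=; last by move=> ->; rewrite F2.
  move=> /Tf Ey; have [z -> Ez] := F1 x.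
  by congr inl; apply: val_inj; rewrite Ez; exact: Ey.
- by move=> H H' T repl v v' Tvv' nt_v; apply: repl_step; apply: replacement_subst.
- move=> H1 H2 H3 T1 T2 T r1 IH1 r2 IH2 TP v v' /TP [u Tvu Tuv'] nt_v.
  have nt_u : lab u \notin terminals A by rewrite -(replacements_lab r1 Tvu).
  apply: (repl_trans (IH1 _ _ Tvu nt_v) (IH2 _ _ Tuv' nt_u)).
  case=> [x|a] [z|b] //= => [|->]; last by exists (inr b).
  move=> /TP [y Txy Tyz].
  have neq_y : y != u.
    apply/eqP=> Ey; rewrite Ey in Txy; move: (valP x).
    by rewrite /= (replacements_inj r1 Txy Tvu) eqxx.
  by exists (inl (exist _ y neq_y)).
Qed.

Variable dec : decoding_system A.

Lemma replacements_dstep (H H' : graph A) (T : H -> H' -> Prop) :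
  replacements T -> forall F, dstep dec H F ->
  exists (F' : graph A) (T' : F -> F' -> Prop), replacements T' /\ dstep dec H' F'.
Proof.
elim=> {H H' T}.
- move=> H H' T f f_iso _ F HF; exists F, (fun x y => y = x); split.
    by apply: repl_iso (is_iso_id F) _.
  by apply: dstep_isol HF; exists f.
- move=> H H' T [Cx [eta [f [f' [ok f_iso f'_iso _]]]]] F.
  move/(dstep_isol (iso_sym (ex_intro _ f f_iso))).
  case=> x [al [y [n1 [n2 [e enc Ex Ey iso_F]]]]].
  have enc_al : al \in Enc A by case: enc.
  have [a [b [Ea Eb]]] := fill_enc_edge plug enc_al e; subst x y.
  pose Cx' := dec_at a al b (@dec_emb A dec al n1 n2 false)
    (@dec_emb A dec al n1 n2 true).
  pose eta' (x : Cx') := if x is inl o then eta o else None.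
  have [g g_iso] := iso_trans (fill_dec _ _ _ _ _ _ _) iso_F.
  (* Tracking serves to match the non-terminals of a derivation; during decoding it can be given
     up. *)
  exists (fill eta' nm'), (fun _ _ => False); split.
    apply: repl_step; exists Cx', eta', g, id; split=> //; last exact: is_iso_id.
    by case=> [o|z] j //= /ok.
  apply: dstep_isol; first by exists f'; exact: f'_iso.
  exists (inl a), al, (inl b), n1, n2; split=> //.
    by move: e; rewrite !fill_edgeE.
  exact: iso_sym (fill_dec _ _ _ _ _ _ _).
- move=> H1 H2 H3 T1 T2 T _ IH1 _ IH2 _ F1 /IH1 [F2 [T1' [r1 /IH2 [F3 [T2' [r2 s]]]]]].
  exists F3, (fun x z => exists2 y, T1' x y & T2' y z); split=> //.
  exact: repl_trans r1 r2 _.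
Qed.

Lemma replacements_dsteps n (H H' F : graph A) (T : H -> H' -> Prop) :
  replacements T -> dsteps dec n H F ->
  exists (F' : graph A) (T' : F -> F' -> Prop), replacements T' /\ dsteps dec n H' F'.
Proof.
elim: n H H' T => [|n IHn] H H' T r /=.
  move=> /iso_sym [f f_iso]; exists H', (fun x y => T (f x) y); split.
    have r0 : replacements (fun x y => y = f x) by apply: (repl_iso f_iso).
    by apply: repl_trans r0 r _ => x y; exists (f x).
  exact: iso_refl.
case=> H1 [HH1 H1F]; have [H1' [T1 [r1 H'H1']]] := replacements_dstep r HH1.
have [F' [T' [r' H1'F']]] := IHn _ _ _ r1 H1F.
by exists F', T'; split=> //; exists H1'.
Qed.

Variable SR : sg_rule A.

Hypothesis fill_apply : forall (Cx : graph A) (eta : Cx -> option J),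
  string_graph (fill eta nm) ->
  sg_apply SR (fill eta nm) (fill eta nm') /\ string_graph (fill eta nm').

(** The string graph property is returned together with the rewriting because the next replacement
    in a chain needs it. *)
Lemma replacements_rewrites (H H' : graph A) (T : H -> H' -> Prop) :
  replacements T -> string_graph H -> sg_rewrites SR H H' /\ string_graph H'.
Proof.
elim=> {H H' T}.
- move=> H H' T f f_iso _ sH; have HH' : iso H H' by exists f.
  split; first by apply: rt_step; left.
  exact: string_graph_iso (iso_sym HH') sH.
- move=> H H' T [Cx [eta [f [f' [ok f_iso f'_iso _]]]]] sH.
  have iso1 : iso (fill eta nm) H by exists f.
  have iso2 : iso (fill eta nm') H' by exists f'.
  have [app s'] := fill_apply (string_graph_iso iso1 sH).
  split; last exact: string_graph_iso (iso_sym iso2) s'.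
  apply: rt_trans; first by apply: rt_step; left; apply: iso_sym iso1.
  by apply: (@rt_trans _ _ _ (fill eta nm')); apply: rt_step; [right|left].
- move=> H1 H2 H3 T1 T2 T _ IH1 _ IH2 _ /IH1 [r1 /IH2 [r2 s]]; split=> //.
  exact: rt_trans r1 r2.
Qed.

End Replacements.

(** * Following vertices through wire-homeomorphisms *)

Section Naming.

Variable A : alphabets.

Lemma wire_terminal (G : graph A) (x : G) : is_wire x -> lab x \in terminals A.
Proof. by move=> wire_x; rewrite inE [_ \in WireL A]wire_x orbT. Qed.

Lemma marked_iso_sym (O : Type) (M N : marked A O) :
  marked_iso M N -> marked_iso N M.
Proof.
case=> f [f_iso nm_f ef]; have [g [g_iso fK gK]] := is_iso_inv f_iso.
exists g; split=> // [x|[[x c] y]]; first by rewrite -nm_f gK.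
by rewrite -ef /emap /= !gK.
Qed.

Lemma marked_homeo_wire (O : Type) (M N : marked A O) :
  marked_homeo M N -> wire_homeo M N.
Proof.
elim=> {M N}.
- move=> M N [[f [f_iso _ _]]|[w [c [_ wire_w enc_c [f [f_iso _ _]]]]]].
    by apply: rst_step; left; exists f.
  by apply: rst_step; right; exists w, c; split=> //; exists f.
- by move=> M; apply: rst_refl.
- by move=> M N _; apply: rst_sym.
- by move=> M N P _ MN _; apply: rst_trans.
Qed.

Definition rename (O O' : Type) (phi : O -> option O') (M : marked A O) :
  marked A O' := @Marked A O' M (fun x => obind phi (name x)) (medges M).

(** Dropping names only enlarges the region, so every split vertex still lies inside it. *)
Lemma marked_homeo_rename (O O' : Type) (phi : O -> option O') (M N : marked A O) :
  marked_homeo M N -> marked_homeo (rename phi M) (rename phi N).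
Proof.
elim=> {M N}.
- move=> M N [[f [f_iso nm_f ef]]|[w [c [un_w wire_w enc_c [f [f_iso nm_f ef]]]]]].
    apply: rst_step; left; exists f; split=> // x /=; by rewrite nm_f.
  apply: rst_step; right; exists w, c; split=> //.
    by move: un_w; rewrite /in_region /=; case: (name w).
  by exists f; split=> // -[v|] /=; rewrite nm_f.
- by move=> M; apply: rst_refl.
- by move=> M N _; apply: rst_sym.
- by move=> M N P _ MN _; apply: rst_trans.
Qed.

Variables (D : graph A) (SV : {set D}) (SE : {set D * Gamma A * D}).

(* nm extends the names of N to all the vertices that wire-homeomorphisms of
   the region leave alone, namely those of the region that are not wires. *)
Record naming (N : marked A D) (nm : N -> option D) : Prop := Naming {
  nm_ext : forall x o, name x = Some o -> nm x = Some o;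
  nm_some : forall x, isSome (nm x) = ~~ (is_wire x && ~~ isSome (name x));
  nm_inj : forall x y, isSome (nm x) -> nm x = nm y -> x = y;
  nm_in : forall x o, ~~ isSome (name x) -> nm x = Some o -> o \in SV;
  nm_out : forall (x : N) o, name x = Some o -> o \notin SV;
  nm_lab : forall x o, nm x = Some o -> lab x = lab o;
  nm_edge : forall x y o o' c, nm x = Some o -> nm y = Some o' ->
    ((x, c, y) \in edges N) = ((o, c, o') \in edges D);
  nm_onto : forall o, (o \notin SV) || ~~ is_wire o -> exists x, nm x = Some o;
  nm_term : forall x c y, ~~ isSome (nm x) ->
    (x, c, y) \in edges N \/ (y, c, x) \in edges N -> lab y \in terminals A }.

Lemma naming_mark :
  (forall x y : D, x \in SV -> is_nonterminal y -> ~~ adjacent x y) ->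
  naming (N := mark SV SE)
    (fun o => if (o \notin SV) || ~~ is_wire o then Some o else None).
Proof.
move=> adj; split.
- by move=> x o /=; case: ifP => // xSV [<-].
- by move=> x /=; case: (x \in SV) => /=; case: (is_wire _).
- by move=> x y; case: ifP => // _ _; case: ifP => // _ [].
- by move=> x o /=; case: ifP => // xSV _; case: ifP => // _ [<-].
- by move=> x o /=; case: ifP => // xSV [<-]; rewrite xSV.
- by move=> x o; case: ifP => // _ [->].
- by move=> x y o o' c; case: ifP => // _ [->]; case: ifP => // _ [->].
- by move=> o keep_o; exists o; rewrite keep_o.
- move=> x c y; case: ifP => // /negbT; rewrite negb_or negbK => /andP [xSV _] _ e.
  apply/negPn/negP=> nt_y; case/negP: (adj _ _ xSV nt_y); apply/existsP; exists c.
  by apply/orP.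
Qed.

Lemma naming_iso (N M : marked A D) (f : N -> M) nmN nmM :
  is_iso f -> (forall x, name (f x) = name x) -> (forall x, nmM (f x) = nmN x) ->
  naming (N := N) nmN -> naming (N := M) nmM.
Proof.
move=> f_iso name_f nm_f [ext some inj inn out labN edge onto term].
have [g [_ fK gK]] := is_iso_inv f_iso.
have lf x : lab (f x) = lab x by case: f_iso.
have nm_g y : nmM y = nmN (g y) by rewrite -nm_f gK.
have name_g y : name y = name (g y) by rewrite -name_f gK.
split.
- by move=> x o; rewrite name_g nm_g; apply: ext.
- by move=> x; rewrite name_g nm_g some /is_wire -(lf (g x)) gK.
- by move=> x y; rewrite !nm_g => sx /(inj _ _ sx) /(can_inj gK).
- by move=> x o; rewrite name_g nm_g; apply: inn.
- by move=> x o; rewrite name_g; apply: out.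
- by move=> x o; rewrite nm_g => /labN <-; rewrite -lf gK.
- move=> x y o o' c; rewrite !nm_g => nx ny.
  by rewrite -(edge _ _ _ _ _ nx ny) -(is_iso_edge _ _ _ f_iso) !gK.
- by move=> o /onto [x nx]; exists (f x); rewrite nm_f.
- move=> x c y; rewrite nm_g => nx e; rewrite -(gK y) lf.
  by apply: (term (g x) c) => //; rewrite -!(is_iso_edge _ _ _ f_iso) !gK.
Qed.

Section NamingSplit.

Variables (N : marked A D) (w : N) (c : Gamma A).
Variables (nm : N -> option D) (nms : split_marked w c -> option D).
Hypothesis un_w : in_region w.
Hypothesis wire_w : is_wire w.
Hypothesis nms_some : forall v, nms (Some v) = nm v.
Hypothesis nms_none : nms None = None.

Lemma split_marked_edgeE x d y :
  ((x, d, y) \in edges (split_marked w c)) =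
  match x, y with
  | Some x, Some y => (x != w) && ((x, d, y) \in edges N)
  | None, Some y => (w, d, y) \in edges N
  | Some x, None => (x == w) && (d == c)
  | None, None => false
  end.
Proof. exact: split_edgesE. Qed.

Lemma naming_split : naming nm -> naming nms.
Proof.
case=> ext some inj inn out labN edge onto term.
have nm_w : ~~ isSome (nm w) by rewrite some wire_w negbK.
have neq_w x o : nm x = Some o -> x != w.
  by move=> nx; apply: contraNneq nm_w => <-; rewrite nx.
split.
- by case=> [x|] o //=; rewrite nms_some; apply: ext.
- by case=> [x|] /=; rewrite ?nms_some ?nms_none ?some //= [is_wire _]wire_w.
- case=> [x|] [y|]; rewrite ?nms_some ?nms_none //;
    first by move=> sx /(inj _ _ sx) ->.
  by case: (nm x).
- by case=> [x|] o; rewrite ?nms_some ?nms_none //; apply: inn.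
- by case=> [x|] o //; apply: out.
- by case=> [x|] o; rewrite ?nms_some ?nms_none //; apply: labN.
- case=> [x|] [y|] o o' d; rewrite ?nms_some ?nms_none // => nx ny.
  by rewrite split_marked_edgeE (neq_w _ _ nx); apply: edge.
- by move=> o /onto [x nx]; exists (Some x); rewrite nms_some.
have tw := wire_terminal wire_w.
case=> [x|] d [y|]; rewrite ?nms_some ?nms_none !split_marked_edgeE //= => nx.
- by case=> /andP [_ e]; apply: (term x d); auto.
by case=> [e|/andP [/eqP -> //]]; apply: (term w d); auto.
Qed.

Lemma naming_merge : naming nms -> naming nm.
Proof.
case=> ext some inj inn out labN edge onto term.
have nm_w : ~~ isSome (nm w).
  by rewrite -nms_some some /= [is_wire _]wire_w negbK.
have neq_w x o : nm x = Some o -> x != w.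
  by move=> nx; apply: contraNneq nm_w => <-; rewrite nx.
split.
- by move=> x o; rewrite -nms_some; apply: (ext (Some x)).
- by move=> x; rewrite -nms_some some.
- by move=> x y; rewrite -!nms_some => sx /(inj _ _ sx) [].
- by move=> x o; rewrite -nms_some; apply: (inn (Some x)).
- by move=> x o; apply: (out (Some x)).
- by move=> x o; rewrite -nms_some; apply: (labN (Some x)).
- move=> x y o o' d nx ny; rewrite -(edge (Some x) (Some y)) ?nms_some //.
  by rewrite split_marked_edgeE (neq_w _ _ nx).
- move=> o /onto [[x|]]; last by rewrite nms_none.
  by rewrite nms_some; exists x.
have tw := wire_terminal wire_w.
move=> x d y nx [e|e].
  have [E|xw] := eqVneq x w.
    apply: (term None d (Some y)); rewrite ?nms_none ?split_marked_edgeE //.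
    by left; rewrite -E.
  apply: (term (Some x) d (Some y)); rewrite ?nms_some ?split_marked_edgeE //.
  by left; rewrite xw.
have [->//|yw] := eqVneq y w.
apply: (term (Some x) d (Some y)); rewrite ?nms_some ?split_marked_edgeE //.
by right; rewrite yw.
Qed.

End NamingSplit.

Definition renamed (N : marked A D) (nm : N -> option D) : marked A D :=
  @Marked A D N nm (medges N).

(** Quantifying over all namings of [N] makes the statement compose along a chain of splittings and
    mergings. *)
Definition naming_transport (N M : marked A D) : Prop :=
  forall nmN, naming (N := N) nmN ->
    exists2 nmM, naming (N := M) nmM & marked_homeo (renamed nmN) (renamed nmM).

Lemma naming_transport_iso N M : marked_iso N M -> naming_transport N M.
Proof.
case=> f [f_iso name_f ef] nmN good; have [g [_ fK _]] := is_iso_inv f_iso.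
exists (fun y => nmN (g y)).
  by apply: naming_iso f_iso name_f _ good => x; rewrite fK.
by apply: rst_step; left; exists f; split=> // x; rewrite /= fK.
Qed.

Lemma naming_transport_trans N M P :
  naming_transport N M -> naming_transport M P -> naming_transport N P.
Proof.
move=> NM MP nmN /NM [nmM /MP [nmP goodP hMP] hNM].
by exists nmP => //; apply: rst_trans hMP.
Qed.

(** The split vertex and its new half are wires of the region, which [nm_some] forbids to name. The
    step therefore remains inside the region after the extra vertices have been named. *)
Lemma naming_transport_split (N : marked A D) (w : N) c :
  in_region w -> is_wire w -> c \notin Enc A ->
  naming_transport N (split_marked w c) /\ naming_transport (split_marked w c) N.
Proof.
move=> un_w wire_w enc_c.
have step nm nms : naming (N := N) nm -> (forall v, nms (Some v) = nm v) ->
    nms None = None ->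
    marked_homeo (renamed nm) (renamed (nms : split_marked w c -> option D)).
  move=> good nms_some nms_none; apply: rst_step; right; exists w, c.
  split=> //; first by rewrite /in_region /= (nm_some good) wire_w negbK.
  exists id; split=> //; first exact: is_iso_id.
    by case=> [v|] /=; rewrite ?nms_some ?nms_none.
  by case=> [[]].
split=> [nm good|nms good].
  pose nms (x : split_marked w c) := if x is Some v then nm v else None.
  exists nms; first exact: naming_split un_w wire_w _ _ good.
  exact: step.
have nms_none : nms None = None.
  by have := nm_some good None; rewrite /= [is_wire _]wire_w; case: (nms None).
have good' : naming (N := N) (fun v => nms (Some v)).
  exact: naming_merge un_w wire_w _ nms_none good.
by exists (fun v => nms (Some v)) => //; apply/rst_sym/step.
Qed.

Lemma naming_transport_homeo N M : marked_homeo N M -> naming_transport N M.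
Proof.
(* Both directions are proved together because the closure is symmetric. *)
move=> NM; suff [] : naming_transport N M /\ naming_transport M N by [].
elim: NM => {N M}.
- move=> N M [NM|[w [c [un_w wire_w enc_c NM]]]].
    by split; apply: naming_transport_iso => //; apply: marked_iso_sym.
  have [t1 t2] := naming_transport_split un_w wire_w enc_c.
  split; first exact: naming_transport_trans t1 (naming_transport_iso NM).
  exact: naming_transport_trans (naming_transport_iso (marked_iso_sym NM)) t2.
- by move=> N; split=> nm good; exists nm => //; apply: rst_refl.
- by move=> N M _ [].
- move=> N M P _ [NM MN] _ [MP PM].
  by split; [apply: naming_transport_trans MP|apply: naming_transport_trans MN].
Qed.

End Naming.

(** Once all corners are string graphs, the gluings are pushouts in their category: [K] is a
    subgraph of [G], and [H] arises by replacement. *)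
Lemma sg_apply_gluing (A : alphabets) (SR : sg_rule A) (F G H K : graph A)
    (k : rI SR -> K) (m : rL SR -> G) (g : K -> G) (n : rR SR -> H) (h : K -> H) :
  string_graph F -> wire_homeo F G ->
  is_gluing (@ri A SR) k m g -> is_gluing (@rj A SR) k n h ->
  (forall e e', e \in edges (rL SR) -> e' \in edges K -> emap m e <> emap g e') ->
  sg_apply SR F H /\ string_graph H.
Proof.
move=> sF FG glueG glueH disj.
have sG : string_graph G by apply/(string_graph_homeo FG).
have sH : string_graph H := string_graph_replace glueG glueH disj sG.
have sK : string_graph K := string_graph_mono (gluing_r glueG) sG.
have sI : string_graph (rI SR) := string_graph_mono (ri_mono SR) (rL_string SR).
have hom_k : is_hom k.
  apply: discrete_hom; first exact: rI_discrete.
  move=> b; case: (gluing_r glueG) => -[<- _] _; rewrite -(gluing_comm glueG).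
  by case: (gluing_l glueG) => -[-> _] _; case: (ri_mono SR) => -[-> _] _.
split=> //; exists G, K, m, g, h; split; first exact: gluing_matching glueG.
exists k, n; split; last first.
  apply: gluing_pushout glueH => //; last by case: (rj_mono SR).
  by split=> //; apply: rR_string.
split.
  apply: gluing_pushout glueG => //; last by case: (ri_mono SR).
  by split=> //; apply: rL_string.
by move=> e e' eL eK /(disj _ _ eL eK).
Qed.

(** * The rewritten body *)

Section RewrittenBody.

Variables (A : alphabets) (SR : sg_rule A).

(* The vertices of D that are untouched by the rewriting are named by
   themselves in D, and their copies in D' carry the same names. *)
Record rewritten_body (D D' : emb_graph A) (nt : D -> D' -> Prop)
    (nm : D -> option D) (nm' : D' -> option D) : Prop := RewrittenBody {
  rb_self : forall x o, nm x = Some o -> x = o;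
  rb_inj : forall x y, isSome (nm' x) -> nm' x = nm' y -> x = y;
  rb_onto : forall o, nm o = Some o -> exists y, nm' y = Some o;
  rb_named : forall y o, nm' y = Some o -> nm o = Some o;
  rb_lab : forall y o, nm' y = Some o -> lab y = lab o;
  rb_edge : forall x y o o' c, nm' x = Some o -> nm' y = Some o' ->
    ((x, c, y) \in edges D') = ((o, c, o') \in edges D);
  rb_plug : pluggable (@lab A D) nm;
  rb_plug' : pluggable (@lab A D) nm';
  rb_nonterminal : forall x, is_nonterminal x -> nm x = Some x;
  rb_nonterminal' : forall y, is_nonterminal y -> isSome (nm' y);
  rb_nt : forall x y, nt x y <-> is_nonterminal x /\ nm' y = Some x;
  rb_has_inst : forall s b c x d, inst s b c x d -> nm x = Some x;
  rb_inst : forall s b c y d,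
    inst s b c y d <-> exists2 x, nm' y = Some x & inst s b c x d;
  rb_wire : wire_functional D';
  rb_enc : enc_exact D';
  rb_end : forall d, #|@is_end A D d| = #|@is_end A D' d|;
  rb_apply : forall (Cx : graph A) (eta : Cx -> option D),
    string_graph (fill eta nm) ->
    sg_apply SR (fill eta nm) (fill eta nm') /\ string_graph (fill eta nm') }.

Section Construction.

Variables (D D' : emb_graph A) (SV : {set D}) (SE : {set D * Gamma A * D}).
Variables (M : marked A D) (K : graph A).
Variables (m : rL SR -> region M) (k : rI SR -> K) (g : K -> M)
  (n : rR SR -> D') (h : K -> D').
Variable nmM : M -> option D.

Let vm (x : rL SR) : M := val (m x).

Hypothesis wire_D : wire_functional D.
Hypothesis enc_D : enc_exact D.
Hypothesis final_SV : final_subgraph SV SE.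
Hypothesis glueM : is_gluing (@ri A SR) k vm g.
Hypothesis glueD' : is_gluing (@rj A SR) k n h.
Hypothesis disj :
  forall e e', e \in edges (rL SR) -> e' \in edges K -> emap vm e <> emap g e'.
Hypothesis homeo : marked_homeo (mark SV SE) M.
Hypothesis good : naming SV nmM.

Let nm0 (o : D) := if (o \notin SV) || ~~ is_wire o then Some o else None.

Hypothesis homeo_nm : marked_homeo (renamed (nm0 : mark SV SE -> _)) (renamed nmM).

(* Names of the vertices in the image of L, which the rewriting deletes. *)
Let dead (o : D) : bool := [exists l, nmM (vm l) == Some o].
Let phi (o : D) : option D := if dead o then None else Some o.

Definition body_name (o : D) : option D := obind phi (nm0 o).
Definition matched_name (x : M) : option D := obind phi (nmM x).
Definition kept_name (y : K) : option D := matched_name (g y).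
(** As [h] is injective, [pick] finds the only preimage in [K]. Vertices contributed by [R] alone
    fall under the default [None]. *)
Definition result_name (y : D') : option D :=
  if [pick z | h z == y] is Some z then kept_name z else None.

Let hom_vm : is_hom vm := proj1 (gluing_l glueM).
Let hom_g : is_hom g := proj1 (gluing_r glueM).
Let inj_g : injective g := proj2 (gluing_r glueM).
Let hom_n : is_hom n := proj1 (gluing_l glueD').
Let hom_h : is_hom h := proj1 (gluing_r glueD').
Let inj_h : injective h := proj2 (gluing_r glueD').

Lemma matched_nameE x o :
  matched_name x = Some o <-> nmM x = Some o /\ ~~ dead o.
Proof.
rewrite /matched_name; case: (nmM x) => [j|] /=; last by split=> // -[].
rewrite /phi; split; first by case: ifP => // nd [<-]; rewrite nd.
by case=> [[->]] /negPf ->.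
Qed.

Lemma body_nameE x o :
  body_name x = Some o <->
  [/\ x = o, (o \notin SV) || ~~ is_wire o & ~~ dead o].
Proof.
rewrite /body_name /nm0; case: ifP => keep_x /=; last first.
  by split=> // -[E]; rewrite -E keep_x.
rewrite /phi; split; first by case: ifP => // nd [<-]; rewrite keep_x nd.
by case=> -> _ /negPf ->.
Qed.

Lemma matched_name_vm l : matched_name (vm l) = None.
Proof.
case E: (matched_name _) => [o|] //; move/matched_nameE: E => [E /negP []].
by apply/existsP; exists l; rewrite E.
Qed.

Lemma kept_name_k b : kept_name (k b) = None.
Proof. by rewrite /kept_name -(gluing_comm glueM) matched_name_vm. Qed.

Lemma result_name_h z : result_name (h z) = kept_name z.
Proof.
rewrite /result_name; case: pickP => [z' /eqP /inj_h -> //|/(_ z)].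
by rewrite eqxx.
Qed.

Lemma result_name_n r : result_name (n r) = None.
Proof.
rewrite /result_name; case: pickP => // z /eqP /esym.
by case/(gluing_meet glueD') => b [_ ->]; rewrite kept_name_k.
Qed.

Lemma result_nameE y o :
  result_name y = Some o <-> exists z, [/\ y = h z, nmM (g z) = Some o & ~~ dead o].
Proof.
split; last by case=> z [-> nz dz]; rewrite result_name_h; apply/matched_nameE.
have [[r ->]|[z ->]] := gluing_cover glueD' y; first by rewrite result_name_n.
by rewrite result_name_h => /matched_nameE [nz dz]; exists z.
Qed.

Lemma region_vm l : name (vm l) = None.
Proof. by have := valP (m l); rewrite /in_region /vm; case: (name _). Qed.

Lemma dead_in o : dead o -> o \in SV.
Proof.
by case/existsP=> l /eqP; apply: (nm_in good); rewrite region_vm.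
Qed.

Lemma body_name_out x : x \notin SV -> body_name x = Some x.
Proof.
move=> xSV; apply/body_nameE; rewrite xSV; split=> //.
by apply: contra xSV; apply: dead_in.
Qed.

Lemma in_terminal x : x \in SV -> lab x \in terminals A.
Proof.
move=> xSV; case: final_SV => _ [term_SV _ _ _] _ _.
have in_x : in_region (x : mark SV SE) by rewrite /in_region /= xSV.
exact: (term_SV (exist _ x in_x)).
Qed.

Lemma body_name_nonterminal x : is_nonterminal x -> body_name x = Some x.
Proof. by move=> nt_x; apply/body_name_out/(contra _ nt_x)/in_terminal. Qed.

Lemma terminal_R (x : rR SR) : lab x \in terminals A.
Proof. by have /string_graphP [t _ _ _] := rR_string SR; apply: t. Qed.

(* A vertex of K whose name was dropped lies in the image of L, hence on the
   interface, whose vertices are unnamed wires. *)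
Lemma kept_name_none z : kept_name z = None -> nmM (g z) = None.
Proof.
rewrite /kept_name /matched_name; case E: (nmM (g z)) => [o|] //=.
rewrite /phi; case: ifP => // /existsP [l /eqP El] _.
have Egl : g z = vm l.
  by apply: (nm_inj good); rewrite E ?El.
have [b [Eb _]] := gluing_meet glueM (esym Egl).
have : isSome (nmM (vm l)) by rewrite El.
have wire_l : is_wire (vm l).
  rewrite (hom_wire _ hom_vm) Eb.
  have /ri_boundary : exists b', @ri A SR b' = ri b by exists b.
  by case/orP=> /andP [].
by rewrite (nm_some good) wire_l region_vm.
Qed.

Lemma unnamed_wire x : nmM x = None -> is_wire x.
Proof.
by move=> nx; have := nm_some good x; rewrite nx => /esym/negbFE/andP [].
Qed.

Lemma result_nonterminal y : is_nonterminal y -> isSome (result_name y).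
Proof.
have [[r ->]|[z ->]] := gluing_cover glueD' y; rewrite /is_nonterminal.
  by case: hom_n => -> _; rewrite terminal_R.
case: hom_h => -> _ nt_z; rewrite result_name_h.
case E: (kept_name z) => //; move/kept_name_none/unnamed_wire/wire_terminal: E.
by case: hom_g => -> _; rewrite (negPf nt_z).
Qed.

(** A named vertex of [D'] stems from [K] and lies outside the images of [L] and [R]. Edges between
    two such vertices are thus those of [K], in [M] as in [D'], and the naming compares [M] with
    [D]. *)
Lemma rewritten_edge x y o o' c :
  result_name x = Some o -> result_name y = Some o' ->
  ((x, c, y) \in edges D') = ((o, c, o') \in edges D).
Proof.
move=> /result_nameE [z [-> nz dz]] /result_nameE [z' [-> nz' dz']].
rewrite -(nm_edge good _ nz nz').
have no_L l z1 o1 : nmM (g z1) = Some o1 -> ~~ dead o1 -> g z1 <> vm l.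
  by move=> nz1 /negP dz1 E; apply: dz1; apply/existsP; exists l; rewrite -E nz1.
have no_R r z1 o1 : nmM (g z1) = Some o1 -> ~~ dead o1 -> h z1 <> n r.
  move=> nz1 dz1 E; have := result_name_n r; rewrite -E result_name_h.
  by rewrite /kept_name (proj2 (matched_nameE (g z1) o1)).
apply/idP/idP.
  case/(gluing_edges glueD') => -[[[u c'] u'] e [E -> E']].
    by case: (no_R _ _ _ nz dz E).
  by move/inj_h: E => ->; move/inj_h: E' => ->; apply: hom_edge.
case/(gluing_edges glueM) => -[[[u c'] u'] e [E -> E']].
  by case: (no_L _ _ _ nz dz E).
by move/inj_g: E => ->; move/inj_g: E' => ->; apply: hom_edge.
Qed.

Lemma enc_M : enc_exact M.
Proof. exact/(enc_exact_homeo (marked_homeo_wire homeo)). Qed.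

Lemma wire_M : wire_functional M.
Proof. exact/(wire_functional_homeo (marked_homeo_wire homeo)). Qed.

Lemma enc_D' : enc_exact D'.
Proof. exact: enc_exact_replace glueM glueD' enc_M. Qed.

(** An encoding edge joins two node-vertices, which keep names, so the edge would also be present in
    [M]. Its matched end is no wire, hence off the interface; there all edges come from [L], which
    has no encoding labels. *)
Lemma dead_no_enc o c o' : dead o ->
  (o, c, o') \in edges D \/ (o', c, o) \in edges D -> c \notin Enc A.
Proof.
move=> /existsP [l /eqP nl] e; apply/negP=> enc_c.
have /andP [node_o node_o'] : is_node o && is_node o'.
  by case: e => /enc_D; rewrite enc_c // => /esym; rewrite andbC.
have node_l : is_node l.
  by rewrite -(hom_node _ hom_vm) /is_node (nm_lab good nl).
have [|x' nx'] := nm_onto good (o := o').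
  by apply/orP; right; apply/negP; apply: not_node_wire.
have no_g z : vm l <> g z.
  case/(gluing_meet glueM) => b [Eb _]; apply: (not_node_wire node_l).
  by have /ri_boundary : exists b', @ri A SR b' = l by [exists b];
    case/orP=> /andP [].
have neL : no_encoding (rL SR) by have /string_graphP [] := rL_string SR.
case: e; rewrite -?(nm_edge good _ nl nx') -?(nm_edge good _ nx' nl).
  case/(gluing_edges glueM) => -[[[u c'] u'] e [E Ec _]]; last by case: (no_g _ E).
  by have := neL _ e; rewrite /= -Ec enc_c.
case/(gluing_edges glueM) => -[[[u c'] u'] e [_ Ec E]]; last by case: (no_g _ E).
by have := neL _ e; rewrite /= -Ec enc_c.
Qed.

Lemma wire_no_enc (G : graph A) (x : G) c y : enc_exact G -> is_wire x ->
  (x, c, y) \in edges G \/ (y, c, x) \in edges G -> c \notin Enc A.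
Proof.
move=> ex wire_x e; apply/negP=> enc_c; apply: (@not_node_wire A G x) wire_x.
by case: e => /ex; rewrite enc_c => /esym /andP [].
Qed.

Lemma body_unnamed o : ~~ isSome (body_name o) -> o \in SV /\ (is_wire o \/ dead o).
Proof.
rewrite /body_name /nm0; case: ifP => [_|/negbT] /=; last first.
  by rewrite negb_or !negbK => /andP [-> ->] _; split=> //; left.
rewrite /phi; case: ifP => // d_o _; split; last by right.
exact: dead_in.
Qed.

Lemma pluggable_body : pluggable (@lab A D) body_name.
Proof.
split.
- by move=> x o /body_nameE [->].
- move=> x c y /body_unnamed [xSV _] e; apply/negPn/negP=> nt_y.
  case: final_SV => _ _ /(_ x y xSV nt_y) /negP adj _; apply: adj.
  by apply/existsP; exists c; apply/orP.
- move=> x c y /body_unnamed [_ [wire_x|dead_x]]; last exact: dead_no_enc.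
  exact: wire_no_enc.
Qed.

(** An edge of [D'] comes from the string graph [R] or from [K]. In the latter case [kept_name_none]
    makes its unnamed end an unnamed wire of [M], where [nm_term] and exactness of encoding labels
    apply. *)
Lemma pluggable_result : pluggable (@lab A D) result_name.
Proof.
split.
- move=> y o /result_nameE [z [-> nz _]]; rewrite -(nm_lab good nz).
  by case: hom_h => -> _; case: hom_g => -> _.
- move=> x c y nx e; apply/negPn/negP=> nt_y.
  have [[r Ey]|[z' Ey]] := gluing_cover glueD' y.
    by move: nt_y; rewrite Ey; case: hom_n => -> _; rewrite terminal_R.
  have noR r : y <> n r.
    by move=> E; move: nt_y; rewrite E; case: hom_n => -> _; rewrite terminal_R.
  have [z Ex eK] : exists2 z, x = h z & (z, c, z') \in edges K \/ (z', c, z) \in edges K.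
    case: e => /(gluing_edges glueD') [] [[[u c'] u'] e [E -> E']].
    + by case: (noR _ E').
    + by exists u => //; left; move: E'; rewrite Ey => /inj_h ->.
    + by case: (noR _ E).
    + by exists u' => //; right; move: E; rewrite Ey => /inj_h ->.
  have nz : nmM (g z) = None.
    apply: kept_name_none; move: nx; rewrite Ex result_name_h.
    by case: (kept_name z).
  case/negP: nt_y; rewrite Ey; case: hom_h => -> _; case: hom_g => <- _.
  apply: (nm_term good (x := g z) (c := c)); first by rewrite nz.
  by case: eK => eK; [left|right]; apply: hom_edge.
- move=> x c y nx e; apply/negP=> enc_c.
  have noR r c' r' : (r, c', r') \in edges (rR SR) -> c <> c'.
    move=> er Ec; have /string_graphP [_ _ _ ne] := rR_string SR.
    by have := ne _ er; rewrite /= -Ec enc_c.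
  have [z [z' [Ex eK]]] : exists z z', x = h z /\
      ((z, c, z') \in edges K \/ (z', c, z) \in edges K).
    case: e => /(gluing_edges glueD') [] [[[u c'] u'] e [E Ec E']].
    + by case: (noR _ _ _ e).
    + by exists u, u'; split=> //; left; rewrite Ec.
    + by case: (noR _ _ _ e).
    + by exists u', u; split=> //; right; rewrite Ec.
  have nz : nmM (g z) = None.
    apply: kept_name_none; move: nx; rewrite Ex result_name_h.
    by case: (kept_name z).
  have := wire_no_enc (x := g z) (c := c) (y := g z') enc_M (unnamed_wire nz).
  case/(_ _)/negP=> //; by case: eK => eK; [left|right]; apply: hom_edge.
Qed.

(** Renaming by [phi] first strips the matched vertices of their names, so that the whole image of
    [L] lies in the plug. The homeomorphism and both gluings of the body then extend to any
    context. *)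
Lemma fill_apply_body (Cx : graph A) (eta : Cx -> option D) :
  string_graph (fill eta body_name) ->
  sg_apply SR (fill eta body_name) (fill eta result_name) /\
  string_graph (fill eta result_name).
Proof.
move=> s_fill.
have k_un b : ~~ isSome (kept_name (k b)) by rewrite kept_name_k.
have m_un l : ~~ isSome (matched_name (vm l)) by rewrite matched_name_vm.
have n_un r : ~~ isSome (result_name (n r)) by rewrite result_name_n.
have nm_g y : matched_name (g y) = kept_name y by [].
have homeo_fill : wire_homeo (fill eta body_name) (fill eta matched_name).
  exact: (fill_homeo eta (marked_homeo_rename phi homeo_nm)).
have glue1 := fill_gluing eta k_un m_un nm_g glueM.
have glue2 := fill_gluing eta k_un n_un result_name_h glueD'.
apply: sg_apply_gluing s_fill homeo_fill glue1 glue2 _.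
move=> [[x c] y] [[[o|x'] c'] [o'|y']] eL //; rewrite fill_edgeE /= => eK [E Ec E'].
by apply: (disj eL eK); rewrite /emap /= E Ec E'.
Qed.

(** [result_name] also follows unmatched node-vertices of the final subgraph, while survival refers
    to the vertices outside it; the clause on [SV] accounts for the difference. *)
Lemma survives_name x y :
  (exists z : K, name (g z) = Some x /\ h z = y) <->
  result_name y = Some x /\ x \notin SV.
Proof.
split=> [[z [nz Ey]]|].
  have xSV := nm_out good nz; split=> //; apply/result_nameE; exists z; split=> //.
    exact: (nm_ext good).
  by apply: contra xSV; apply: dead_in.
case=> /result_nameE [z [-> nz _]] xSV; exists z; split=> //.
case E: (name (g z)) => [o|].
  by move: (nm_ext good E); rewrite nz => ->.
by move: xSV; rewrite (nm_in good _ nz) // E.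
Qed.

Lemma rewritten_bodyP (nt : D -> D' -> Prop) :
  (forall s b c (y : D') d, inst s b c y d <-> exists2 x : D,
     (exists z : K, name (g z) = Some x /\ h z = y) & inst s b c x d) ->
  (forall x y, nt x y <-> is_nonterminal x /\
     (exists z : K, name (g z) = Some x /\ h z = y)) ->
  rewritten_body nt body_name result_name.
Proof.
move=> instP ntP.
have inst_out s b c x d : inst s b c x d -> x \notin SV.
  move=> ix; apply/negP=> xSV; case: final_SV => _ _ _ /(_ _ xSV); apply.
  by exists s, b, c, d.
split.
- by move=> x o /body_nameE [].
- move=> x y; case E: (result_name x) => [o|] // _ /esym.
  move: E => /result_nameE [z [-> nz _]] /result_nameE [z' [-> nz' _]].
  by congr h; apply: inj_g; apply: (nm_inj good); rewrite nz ?nz'.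
- move=> o /body_nameE [_ keep_o dead_o].
  have [x nx] := nm_onto good keep_o.
  have [[l El]|[z Ez]] := gluing_cover glueM x.
    by case/negP: dead_o; apply/existsP; exists l; rewrite -El nx.
  by exists (h z); apply/result_nameE; exists z; rewrite -Ez.
- move=> y o /result_nameE [z [_ nz dead_o]]; apply/body_nameE; split=> //.
  case E: (name (g z)) => [o'|].
    by move: (nm_ext good E); rewrite nz => -[->]; rewrite (nm_out good E).
  have := nm_some good (g z); rewrite nz E andbT => /esym nw.
  by rewrite /is_wire -(nm_lab good nz) [X in _ || X]nw orbT.
- exact: (plug_lab pluggable_result).
- exact: rewritten_edge.
- exact: pluggable_body.
- exact: pluggable_result.
- exact: body_name_nonterminal.
- exact: result_nonterminal.
- move=> x y; rewrite ntP survives_name; split=> [[? []]|[nt_x E]] //.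
  by do 2!split=> //; apply/(contra _ nt_x)/in_terminal.
- by move=> s b c x d /inst_out; apply: body_name_out.
- move=> s b c y d; rewrite instP.
  split=> [[x /survives_name [E _] ix]|[x E ix]]; exists x => //.
  by apply/survives_name; split=> //; apply: inst_out ix.
- exact: wire_functional_replace glueM glueD' disj wire_M.
- exact: enc_D'.
- move=> d; rewrite -(card_is_end_replace glueM glueD').
  exact: card_is_end_homeo (marked_homeo_wire homeo).
- exact: fill_apply_body.
Qed.

End Construction.

Lemma rewritten_production_body (p p' : production A) (nt : p -> p' -> Prop) :
  wire_functional p -> enc_exact p -> rewritten_production SR nt ->
  exists nm nm', rewritten_body nt nm nm'.
Proof.
move=> wire_p enc_p [_ [SV [SE [M [K [m [g [h [fin homeo match_m dpo [instP ntP]]]]]]]]]].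
case: dpo => k [n [[po1 compl] po2]].
have [_ _ [hom_m inj_m] _] := match_m.
have inj_vm : injective (fun x => val (m x)) by move=> x y /val_inj /inj_m.
have comm x : val (m (ri x)) = g (k x) by case: po1 => _ _ /(_ x).
have inj_ri : injective (@ri A SR) by case: (ri_mono SR).
have inj_rj : injective (@rj A SR) by case: (rj_mono SR).
have inj_k : injective k.
  by move=> x y E; apply/inj_ri/inj_vm; rewrite !comm E.
have glueM := pushout_gluing inj_ri inj_k po1.
have glueD' := pushout_gluing inj_rj inj_k po2.
have disj := pushout_complement_disjoint (conj po1 compl).
have adj : forall x y : p, x \in SV -> is_nonterminal y -> ~~ adjacent x y.
  by case: fin.
have [nmM good homeo_nm] := naming_transport_homeo homeo (naming_mark SE adj).
exists (body_name SV m nmM), (result_name m g h nmM).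
exact: (@rewritten_bodyP _ _ SV SE M K m k g n h nmM).
Qed.

End RewrittenBody.

(** * Derivations and the transformed grammar *)

Section RewrittenBodyTheory.

Variables (A : alphabets) (SR : sg_rule A) (D D' : emb_graph A).
Variables (nt : D -> D' -> Prop) (nm : D -> option D) (nm' : D' -> option D).
Hypothesis rb : rewritten_body SR nt nm nm'.

Lemma induced_irrefl (P : pred D) x c y :
  (x, c, y) \in [set e : {x | P x} * Gamma A * {x | P x}
                 | emap val e \in edges D] -> x != y.
Proof. by rewrite inE => e; apply: contra (edges_irrefl e) => /eqP ->. Qed.

Definition induced (P : pred D) : emb_graph A :=
  @EmbGraph A (Graph (fun x : {x | P x} => lab (val x)) (@induced_irrefl P))
    (fun s b c x d => inst s b c (val x) d).

Let Cx : emb_graph A := induced (fun o => isSome (nm o)).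
Let eta (o : Cx) : option D := Some (val o).

Let named o : isSome (nm o) -> nm o = Some o.
Proof. by case E: (nm o) => [o'|] // _; rewrite (rb_self rb E). Qed.

Lemma body_context : exists f : fill_emb eta nm -> D,
  [/\ is_iso f, forall o, f (inl o) = val o &
      forall s b c x d, inst s b c (f x) d = inst s b c x d].
Proof.
have [||||||f [f_iso f_l f_r]] := @fill_self A D Cx eta D nm.
- by move=> x y [/val_inj].
- by move=> x y nx; rewrite named // => /esym /(rb_self rb).
- by move=> o; exists (val o); [exact: (valP o)|rewrite named ?(valP o)].
- by move=> x nx; exists (exist _ x nx); rewrite named.
- by move=> x o nx; rewrite named // => -[->].
- by move=> x y o o' c nx ny; rewrite (named nx) (named ny) => -[->] [->];
    rewrite inE.
have f_o o : f (inl o) = val o by have [_ /(rb_self rb)] := f_l o.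
exists f; split=> // s b c [o|x] d /=; first by rewrite f_o.
rewrite f_r; apply/negP=> /(rb_has_inst rb) E.
by have := valP x; rewrite E.
Qed.

Lemma rewritten_context : exists f : fill_emb eta nm' -> D',
  [/\ is_iso f, forall o, nm' (f (inl o)) = Some (val o) &
      forall s b c x d, inst s b c (f x) d = inst s b c x d].
Proof.
have [||||||f [f_iso f_l f_r]] := @fill_self A D Cx eta D' nm'.
- by move=> x y [/val_inj].
- exact: (rb_inj rb).
- move=> o; have [y Ey] := rb_onto rb (named (valP o)).
  by exists y; rewrite Ey.
- move=> y; case E: (nm' y) => [o|] // _.
  have no : isSome (nm o) by rewrite (rb_named rb E).
  by exists (exist _ o no).
- by move=> y o _ /(rb_lab rb).
- by move=> x y o o' c _ _ nx ny; rewrite (rb_edge rb _ nx ny) inE.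
exists f; split=> // [o|s b c [o|x] d]; first by have [_ ->] := f_l o.
  have [_ fo] := f_l o.
  apply/idP/idP=> [/(rb_inst rb) [x]|io]; first by rewrite fo => -[<-].
  by apply/(rb_inst rb); exists (val o).
rewrite f_r; apply/negP=> /(rb_inst rb) [y E].
by have := valP x; rewrite E.
Qed.

(** Both bodies are fillings of the same context, the named vertices of [D], with the same
    instructions on it and none on the plugs. Inserting them at [v] yields one context with two
    plugs. *)
Lemma rewritten_replacement (H : graph A) (v : H) :
  replacement (@lab A D) nm nm'
    (subst_track (v1 := v) (v2 := v) (D1 := D) (D2 := D') eq nt).
Proof.
have [f [f_iso f_l f_inst]] := body_context.
have [f' [f'_iso f'_l f'_inst]] := rewritten_context.
have [G [G_iso G1 G2]] := subst_fill v eta nm.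
have [G' [G'_iso G'1 G'2]] := subst_fill v eta nm'.
have [F [F_iso F1 F2]] := subst_iso (is_iso_id H) (erefl v) f_iso f_inst.
have [F' [F'_iso F'1 F'2]] := subst_iso (is_iso_id H) (erefl v) f'_iso f'_inst.
exists (subst_graph v Cx), (eta_body eta), (F \o G), (F' \o G'); split.
- by case=> [w|o] //= j [<-].
- exact: is_iso_comp.
- exact: is_iso_comp.
case=> [x|x] [y|y] //=.
  move/val_inj <-; exists (inl x).
    by rewrite G1; have [z -> Ez] := F1 x; congr inl; apply: val_inj.
  by rewrite G'1; have [z -> Ez] := F'1 x; congr inl; apply: val_inj.
move=> /(rb_nt rb) [_ ny].
have nx : isSome (nm x) by rewrite (rb_named rb ny).
exists (inr (exist _ x nx)); first by rewrite G2 F2 f_l.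
rewrite G'2 F'2; congr inr; apply: (rb_inj rb); first by rewrite ny.
by rewrite f'_l ny.
Qed.

Lemma rewritten_nt_bijection : nt_bijection nt.
Proof.
split.
- move=> x y /(rb_nt rb) [nt_x ny]; have E := rb_lab rb ny.
  by split=> //; rewrite /is_nonterminal E.
- move=> x nt_x; have [y ny] := rb_onto rb (rb_nonterminal rb nt_x).
  exists y; split; first exact/(rb_nt rb).
  by move=> y' /(rb_nt rb) [_ ny']; apply: (rb_inj rb); rewrite ny ?ny'.
- move=> y nt_y; case E: (nm' y) (rb_nonterminal' rb nt_y) => [x|] // _.
  exists x; split=> [|x' /(rb_nt rb) [_]]; last by rewrite E => -[].
  by apply/(rb_nt rb); split=> //; rewrite /is_nonterminal -(rb_lab rb E).
Qed.

End RewrittenBodyTheory.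

Section Correspondences.

Variable A : alphabets.

Lemma same_production_eq (p p' : production A) (nt : p -> p' -> Prop) :
  same_production nt -> p' = p.
Proof. by case. Qed.

Lemma same_production_nt (p p' : production A) (nt : p -> p' -> Prop) :
  same_production nt -> nt_bijection nt.
Proof.
case=> {}nt ntP; split.
- by move=> x y /ntP [nt_x <-].
- by move=> x nt_x; exists x; split=> [|y /ntP [_ ->]] //; apply/ntP.
- by move=> x nt_x; exists x; split=> [|y /ntP [_ ->]] //; apply/ntP.
Qed.

Lemma equipotent_card (G1 G2 : graph A) (P1 : pred G1) (P2 : pred G2) :
  #|P1| = #|P2| -> equipotent P1 P2.
Proof.
move=> E; have E' : #|{: {x | P1 x}}| = #|{: {x | P2 x}}|.
  by rewrite !card_sig.
exists (fun x => enum_val (cast_ord E' (enum_rank x))).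
exists (fun y => enum_val (cast_ord (esym E') (enum_rank y))) => x.
  by rewrite enum_valK cast_ordK enum_rankK.
by rewrite enum_valK cast_ordKV enum_rankK.
Qed.

Section Replacements.

Variables (J : finType) (labJ : J -> Sigma A) (D D' : graph A).
Variables (nm : D -> option J) (nm' : D' -> option J).
Hypothesis plug : pluggable labJ nm.
Hypothesis plug' : pluggable labJ nm'.

Lemma replacements_sub (H H' : graph A) (T T' : H -> H' -> Prop) :
  replacements labJ nm nm' T -> (forall x y, T' x y -> T x y) ->
  replacements labJ nm nm' T'.
Proof.
move=> r sub; have r0 : replacements labJ nm nm' (fun x y : H => y = x).
  exact: repl_iso (is_iso_id H) _.
by apply: repl_trans r0 r _ => x y /sub; exists x.
Qed.

Lemma replacements_same (p p' : production A) (nt : p -> p' -> Prop) :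
  same_production nt ->
  forall (H H' : graph A) (T : H -> H' -> Prop) (v : H) (v' : H'),
  replacements labJ nm nm' T -> T v v' -> lab v \notin terminals A ->
  replacements labJ nm nm' (subst_track (v1 := v) (v2 := v') T nt).
Proof.
case=> {}nt ntP H H' T v v' r Tvv' nt_v.
apply: replacements_sub (replacements_subst plug plug' p r Tvv' nt_v) _.
by case=> [x|x] [y|y] //= /ntP [].
Qed.

End Replacements.

End Correspondences.

(** * Invariants of sentential forms *)

Section Derivations.

Variables (A : alphabets) (B : ESG A).
Hypothesis besg : is_BESG B.

(** Exactness of encoding labels is limited to edges between terminals: instructions at a
    non-terminal may produce encoding labels on edges there. *)
Definition sentential (H : graph A) : Prop :=
  wire_functional H /\
  (forall (x : H) c y, lab x \in terminals A -> lab y \in terminals A ->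
     (x, c, y) \in edges H -> (c \in Enc A) = is_node x && is_node y).

Lemma besg_wire (p : pidx B) : wire_functional (prods p).
Proof. exact/wire_functionalP/(besg_W1 besg). Qed.

Lemma besg_enc (p : pidx B) : enc_exact (prods p).
Proof. by move=> x c y /(besg_N1 besg). Qed.

Lemma inst_enc (p : pidx B) s b c (x : prods p) d :
  inst s b c x d -> s \in terminals A -> lab x \in terminals A ->
  (c \in Enc A) = (s \in NodeL A) && is_node x.
Proof.
move=> ix; have := besg_W2 besg ix; rewrite /is_wire => not_wire.
rewrite !inE (negPf not_wire) orbF => /orP [node_s|wire_s] node_x.
  by rewrite (besg_N2 besg ix) ?node_s ?[is_node x]node_x.
have [_ /(_ _ _ ix) /negPf ->] := besg_W3 besg p b d wire_s.
by rewrite (disjointFl (node_wire_disjoint A) wire_s).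
Qed.

(** If an old wire had its single edge of some direction at [v], (W3) produces at most one successor
    of that edge; (W2) gives the wires of the body no edge to the host. Labels between host and body
    are settled by [inst_enc]. *)
Lemma sentential_subst (H : graph A) (v : H) (p : pidx B) :
  sentential H -> sentential (subst_graph v (prods p)).
Proof.
case=> wH eH; split.
  (* The direction flips because instructions record it relative to [v], whereas here it is relative
     to [x]. *)
  have liftH (x : {x | x != v}) w c d :
      @edge_dir A (subst_graph v (prods p)) (inl x) w c d ->
      match w return Prop with
      | inl w => edge_dir (val x) (val w) c d
      | inr a => exists b, edge_dir (val x) v b d /\
          inst (lab (val x)) b c a (if d is d_in then d_out else d_in)
      end.
    case: d w => -[w|a] /=; rewrite subst_edgeE //=;
      by case/existsP=> b /andP [e ia]; exists b.
  case=> [x|a] d w c w' c' wire_x.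
    move=> /liftH e1 /liftH e2; case: w w' e1 e2 => [w|a] [w'|a'].
    + by move=> e1 e2; have [/val_inj -> ->] := wH _ _ _ _ _ _ wire_x e1 e2.
    + move=> e1 [b [e2 _]]; have [E _] := wH _ _ _ _ _ _ wire_x e1 e2.
      by case/eqP: (valP w).
    + move=> [b [e1 _]] e2; have [E _] := wH _ _ _ _ _ _ wire_x e1 e2.
      by case/eqP: (valP w').
    + move=> [b [e1 i1]] [b' [e2 i2]].
      have [_ E] := wH _ _ _ _ _ _ wire_x e1 e2; rewrite -E in i2.
      have [/(_ _ _ _ _ i1 i2) [-> ->] _] := besg_W3 besg p b
        (if d is d_in then d_out else d_in) wire_x.
      by [].
  have liftD z b e : @edge_dir A (subst_graph v (prods p)) (inr a) z b e ->
      exists2 a', z = inr a' & edge_dir a a' b e.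
    case: e z => -[z|a'] /=; rewrite subst_edgeE /=;
      try (by move=> ea; exists a');
      by case/existsP=> b' /andP [_ /(besg_W2 besg)]; rewrite [is_wire _]wire_x.
  move=> /liftD [a1 -> e1] /liftD [a2 -> e2].
  by have [-> ->] := @besg_wire p a d _ _ _ _ wire_x e1 e2.
case=> [x|a] c [y|b] tx ty; rewrite subst_edgeE /=.
- exact: eH.
- by case/existsP=> b' /andP [_ ib]; apply: inst_enc ib _ _.
- by case/existsP=> b' /andP [_ ib]; rewrite andbC; apply: inst_enc ib _ _.
- exact: besg_enc.
Qed.

Lemma sentential_parallel (B' : ESG A) (c : correspondence B B')
    (H1 H2 : graph A) (r : H1 -> H2 -> Prop) : parallel c r -> sentential H1.
Proof.
elim=> {H1 H2 r} [|H1 H2 r v1 v2 p _ sH _ _ _]; last exact: sentential_subst.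
by split=> [v [] w b w' b' _|x b y _ _]; rewrite /= inE.
Qed.

End Derivations.

(** * The transformed grammar and its derivations *)

Section Transformation.

Variables (A : alphabets) (B B' : ESG A) (SR : sg_rule A).
Variable c : correspondence B B'.
Hypothesis besg : is_BESG B.
Hypothesis term_eq : term B' = term B.
Hypothesis final_eq : final B' = final B.
Hypothesis start_eq : start B' = start B.
Hypothesis decoder_eq : decoder B' = decoder B.
Variable p : pidx B.
Hypothesis lhs_p : lhs (prods (corr c p)) = lhs (prods p).
Variables (nm : prods p -> option (prods p))
  (nm' : prods (corr c p) -> option (prods p)).
Hypothesis rb : rewritten_body SR (corr_nt (c := c) (p := p)) nm nm'.
Hypothesis same :
  forall q, q != p -> same_production (corr_nt (c := c) (p := q)).

(** As [corr] is onto, the productions of [B'] are the rewritten one and productions of [B]; each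
    grammar condition needs a check at the former only. *)
Lemma transformed_prods (Phi : production A -> Prop) :
  (forall q : pidx B, Phi (prods q)) -> Phi (prods (corr c p)) ->
  forall q : pidx B', Phi (prods q).
Proof.
move=> PhiB Phip q; have [ci _ cK] := corr_bij c; rewrite -(cK q).
have [-> //|neq] := eqVneq (ci q) p.
by rewrite (same_production_eq (same neq)).
Qed.

Lemma transformed_inst w b d (Y : Sigma A) :
  (forall q : pidx B, lhs (prods q) = Y ->
     exists e (z : prods q), inst w b e z d) ->
  forall q : pidx B', lhs (prods q) = Y ->
    exists e (z : prods q), inst w b e z d.
Proof.
move=> instB.
apply: (transformed_prods
  (Phi := fun P => lhs P = Y -> exists e (z : P), inst w b e z d)) => //.
rewrite lhs_p => /instB [e [z iz]].
have [y ny] := rb_onto rb (rb_has_inst rb iz).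
by exists e, y; apply/(rb_inst rb); exists z.
Qed.

Lemma transformed_besg : is_BESG B'.
Proof.
have term_B := besg_term besg.
split.
- by rewrite term_eq.
- by rewrite final_eq (besg_final besg).
- apply: (transformed_prods (Phi := fun P =>
    (forall e, e \in edges P -> (lab e.1.1 \in term B') || (lab e.2 \in term B')) /\
    (forall s b e (x : P) d, inst s b e x d -> s \in term B'))).
    by move=> q; rewrite term_eq; apply: (besg_boundary besg).
  rewrite term_eq term_B; split; last first.
    move=> s b e y d /(rb_inst rb) [x _].
    by rewrite -term_B; apply: (proj2 (besg_boundary besg p)).
  case=> [[x b] y] e /=; apply/negPn; rewrite negb_or; apply/negP=> /andP [ntx nty].
  have := rb_nonterminal' rb ntx; case Ex: (nm' x) => [o|] // _.
  have := rb_nonterminal' rb nty; case Ey: (nm' y) => [o'|] // _.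
  rewrite (rb_edge rb _ Ex Ey) in e.
  have := proj1 (besg_boundary besg p) _ e; rewrite term_B /=.
  by rewrite -(rb_lab rb Ex) -(rb_lab rb Ey) (negPf ntx) (negPf nty).
- apply: (transformed_prods (Phi := fun P => forall e, e \in edges P ->
    (e.1.2 \in Enc A) = (is_node e.1.1 && is_node e.2))).
    by move=> q; apply: (besg_N1 besg).
  by case=> [[x b] y] /(rb_enc rb).
- apply: (transformed_prods (Phi := fun P => forall s b e (x : P) d,
    inst s b e x d -> s \in NodeL A -> is_node x -> e \in Enc A)).
    by move=> q; apply: (besg_N2 besg).
  move=> s b e y d /(rb_inst rb) [x nx ix] node_s.
  by rewrite /is_node (rb_lab rb nx); apply: (besg_N2 besg ix).
- apply: (transformed_prods (Phi := fun P => wire_degrees P)).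
    by move=> q; apply: (besg_W1 besg).
  exact/wire_functionalP/(rb_wire rb).
- apply: (transformed_prods (Phi := fun P => forall s b e (x : P) d,
    inst s b e x d -> ~~ is_wire x)).
    by move=> q; apply: (besg_W2 besg).
  move=> s b e y d /(rb_inst rb) [x nx ix].
  by rewrite /is_wire (rb_lab rb nx); apply: (besg_W2 besg ix).
- apply: (transformed_prods (Phi := fun P => forall w b d, w \in WireL A ->
    (forall e e' (x x' : P), inst w b e x d -> inst w b e' x' d -> e = e' /\ x = x') /\
    (forall e (x : P), inst w b e x d -> e \notin Enc A))).
    by move=> q; apply: (besg_W3 besg).
  move=> w b d wire_w; have [uniq_i enc_i] := besg_W3 besg p b d wire_w.
  split=> [e e' y y'|e y]; last by move=> /(rb_inst rb) [x _]; apply: enc_i.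
  move=> /(rb_inst rb) [x nx ix] /(rb_inst rb) [x' nx' ix'].
  have [-> E] := uniq_i _ _ _ _ ix ix'; split=> //.
  by apply: (rb_inj rb); rewrite nx ?nx' ?E.
- apply: (transformed_prods (Phi := fun P => forall (y : P) w b d,
    is_nonterminal y -> w \in WireL A ->
    (exists2 u : P, lab u = w & edge_dir y u b d) \/ (exists a, inst w a b y d) ->
    forall q : pidx B', lhs (prods q) = lab y ->
    exists e (z : prods q), inst w b e z d)).
    move=> q y w b d nt_y wire_w cond; apply: transformed_inst.
    exact: (besg_W4 besg nt_y wire_w cond).
  move=> y w b d nt_y wire_w cond; apply: transformed_inst.
  have := rb_nonterminal' rb nt_y; case Ey: (nm' y) => [x|] // _.
  have nt_x : is_nonterminal x by rewrite /is_nonterminal -(rb_lab rb Ey).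
  rewrite (rb_lab rb Ey); apply: (besg_W4 besg nt_x wire_w).
  case: cond => [[u lab_u e]|[a /(rb_inst rb) [x']]]; last first.
    by rewrite Ey => -[<-] ix; right; exists a.
  (* A neighbour of a non-terminal lies outside the plug, so it is named and the same edge is
     already present in the body of [p]. *)
  left; have nu : isSome (nm' u).
    apply/negPn/negP=> nu; case/negP: nt_y.
    apply: (plug_term (rb_plug' rb) nu (c := b)).
    by case: d e => e; [left|right].
  case Eu: (nm' u) nu => [o|] // _; exists o; first by rewrite -(rb_lab rb Eu).
  by case: d e => /=; rewrite ?(rb_edge rb _ Eu Ey) ?(rb_edge rb _ Ey Eu).
Qed.

Lemma transformed_pattern : rewrite_pattern c.
Proof.
split=> //.
- exact: transformed_besg.
- move=> q; have [->//|neq] := eqVneq q p.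
  by rewrite (same_production_eq (same neq)).
- move=> q; have [->|neq] := eqVneq q p; first exact: rewritten_nt_bijection rb.
  exact: same_production_nt (same neq).
- move=> q; have [->|neq] := eqVneq q p.
    by split; apply: equipotent_card;
      [apply: (rb_end rb d_in)|apply: (rb_end rb d_out)].
  by rewrite (same_production_eq (same neq)); split; apply: equipotent_card.
Qed.

Lemma parallel_replacements (H1 H2 : graph A) (r : H1 -> H2 -> Prop) :
  parallel c r -> replacements (@lab A (prods p)) nm nm' r.
Proof.
elim=> {H1 H2 r} [|H1 H2 r v1 v2 q _ IH r12 lab1 lab2].
  apply: (repl_iso _ _ _
    (f := fun x : single_graph (start B) => (x : single_graph (start B')))).
    by apply: is_isoI => // y; exists y.
  by move=> [] [].
have nt_v1 : lab v1 \notin terminals A.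
  by rewrite lab1 -(besg_term besg); apply: lhs_nonterminal.
have plug := rb_plug rb; have plug' := rb_plug' rb.
have [E|neq] := eqVneq q p; last exact: replacements_same (same neq) _ _ _ _ _ _ _ _.
(* A use of [p] is taken in two stages: first the old body is inserted on both sides, then it is
   exchanged for the new body in the second graph, which adds one replacement. *)
subst q; have r1 := replacements_subst plug plug' (prods p) IH r12 nt_v1.
have r2 := repl_step (rewritten_replacement rb v2).
apply: repl_trans r1 r2 _ => -[x|x] [y|y] //= xy; first by exists (inl y).
by exists (inr x).
Qed.

Lemma transformed_admissible : admissible SR c.
Proof.
move=> F1 F2 [H1 [H2 [r [par [term1 _] dec1 dec2]]]].
have [n H1F1] := decodes_dsteps dec1.
have [k H2F2] := decodes_dsteps dec2; rewrite decoder_eq in H2F2.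
have [F' [T [repl H2F']]] :=
  replacements_dsteps (rb_plug rb) (parallel_replacements par) H1F1.
have [wire1 enc1] := sentential_parallel besg par.
have t1 : all_terminal H1 by move=> v; rewrite -(besg_term besg).
have [tF wF eF] : encoded_string_graph F1.
  by apply: dsteps_encoded H1F1 _; split=> // x b y; apply: enc1.
have [_ neF1] := dec1; have [_ neF2] := dec2.
have sF1 : string_graph F1 by apply/string_graphP.
have [rew sF'] := replacements_rewrites (rb_apply rb) repl sF1.
(* This makes [F'] a complete decoding of [H2], like [F2], so uniqueness identifies the two. *)
have neF' : no_encoding F' by case/string_graphP: sF'.
apply: rt_trans rew _; apply: rt_step; left.
exact: dsteps_unique neF' neF2 H2F' H2F2.
Qed.

End Transformation.

Theorem theorem6 (A : alphabets) (B B' : ESG A) (SR : sg_rule A)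
    (c : correspondence B B') :
  is_BESG B ->
  transformation_step SR c ->
  rewrite_pattern c /\ admissible SR c.
Proof.
move=> besg [term_eq final_eq start_eq decoder_eq [p [rew same]]].
have lhs_p : lhs (prods (corr c p)) = lhs (prods p) by case: rew.
have [nm [nm' rb]] :=
  rewritten_production_body (besg_wire besg (p := p)) (besg_enc besg (p := p)) rew.
split; first exact: (transformed_pattern besg term_eq final_eq start_eq
  decoder_eq lhs_p rb same).
exact: (transformed_admissible besg start_eq decoder_eq rb same).
Qed.
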